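(* Let $k$ be a field of characteristic $p>0$ and let $H$ be a finite-dimensional pointed Hopf algebra of rank one over $k$ that is generated as an algebra by $H_1$. Let $a$ be the skew point of $H$. Assume there exists an eigenvector in $P_{a,1}\setminus H_0$ of the conjugation action of $a$, with eigenvalue $q$. If $q\neq 1$, then $H$ is isomorphic (as a Hopf algebra) to a Hopf algebra $H_R$ given by a tuple $R$ with $r=0$. If $q=1$ and $k$ is algebraically closed, then $H$ is isomorphic to a Hopf algebra $H_F$ given by a tuple $F$.
   Context: For a finite-dimensional Hopf algebra $H$ over $k$: $G(H)$ is the group of group-like elements; the coradical $H_0$ is the sum of the simple subcoalgebras; $H_1=\Delta^{-1}(H\otimes H_0+H_0\otimes H)$. $H$ is pointed if all simple subcoalgebras are one-dimensional, so that $H_0=kG(H)$. For $g,h\in G(H)$, $P_{g,h}=\{c\in H:\Delta(c)=c\otimes g+h\otimes c\}$. An element $a\in G(H)$ is a skew point if $P_{a,1}\setminus H_0\neq\emptyset$. A pointed $H$ has rank $t$ if $\dim_k k\otimes_{H_0}H_1=t+1$ ($k$ trivial via the counit). A pointed rank one Hopf algebra has exactly one skew point, and it is central in $G(H)$. First type $H_R$. Let $R=(G,\chi,a,\alpha)$ where $G$ is a finite group, $a\in Z(G)$, $\chi:G\to k^*$ a linear character with $\chi(a)\ne 1$, $\alpha=(\alpha_{-1},\alpha_0,\dots,\alpha_{r-1})\in k^{r+1}$, $r\ge 0$. Let $N$ be the order of $\chi(a)$ and $n=p^rN$. It is assumed that $\alpha_{-1}=0$ if $a^n=1$; that if $\alpha_i\ne0$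 for some $i\ge0$ then $a^{N(p^r-p^i)}=1$ and $\chi(g)^{N(p^r-p^i)}=1$ for all $g\in G$; and that if $\alpha_{-1}\neq0$ then $\chi(g)^{Np^r}=1$ for all $g\in G$. $H_R$ is the algebra containing $kG$ and an element $x$, with basis $(gx^i)_{g\in G,\,0\le i\le n-1}$ and relations $gxg^{-1}=\chi(g)x$ ($g\in G$), $x^n=\alpha_{-1}(a^n-1)+\sum_{i=0}^{r-1}\alpha_ix^{p^iN}$; its Hopf structure is $\Delta(gx^i)=(g\otimes g)(x\otimes a+1\otimes x)^i$, $\epsilon(gx^i)=\delta_{i,0}$, $S(gx^i)=(-xa^{-1})^ig^{-1}$. Second type $H_F$. Let $F=(G,\chi,c,a,(\alpha_{-1},\alpha_0))$ where $G$ is a finite group, $a\in Z(G)$, $\chi:G\to k^*$ a linear character with $\chi(a)=1$, $c:G\to k$ a map with $c(hg)=\chi(g)c(h)+c(g)$ for all $g,h\in G$ and $c(a)=0$, and $\alpha_{-1},\alpha_0\in k$ with $\alpha_0\in\{0,1\}$ and $\alpha_{-1}=0$ if $\alpha_0=0$. It is assumed that if $\alpha_0=0$ then $c(g)(a^p-1)=0$ in $kG$ for all $g\in G$; and if $\alpha_0=1$ then $a^p=a$, and for all $g\in G$ one has $\chi(g)\in\mathbb{F}_p^*$ and $(\alpha_{-1}(\chi(g)-1)+c(g)^p-c(g))(a-1)=0$ in $kG$. $H_F$ is the algebra containing $kG$ and an element $x$, with basis $\{gx^i: g\in G,0\le i\le p-1\}$ and relations $x^p=\alpha_{-1}(a^p-1)+\alpha_0x$,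 $gxg^{-1}=\chi(g)x+c(g)(a-1)$ ($g\in G$); its Hopf structure is $\Delta(gx^i)=(g\otimes g)(x\otimes a+1\otimes x)^i$, $\epsilon(gx^i)=\delta_{i,0}$, $S(gx^i)=(-xa^{-1})^ig^{-1}$. *)

(* Defs.v *)
From HB Require Import structures.
From mathcomp Require Import all_boot all_order all_fingroup all_algebra.
From mathcomp Require Import all_solvable all_field.
From mathcomp Require Import boolp classical_sets.

Set Implicit Arguments.
Unset Strict Implicit.
Unset Printing Implicit Defensive.

Import GRing.Theory.
Local Open Scope ring_scope.

Section SpanSet.
Variables (k : fieldType) (V : vectType k).

Lemma spanset_exists (S : set V) : exists U : {vspace V},
  (forall x, S x -> x \in U) /\
  (forall W : {vspace V}, (forall x, S x -> x \in W) -> (U <= W)%VS).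
Proof.
pose P n := `[< exists s : seq V, (forall x, x \in s -> S x) /\ \dim <<s>> = n >].
have exP : exists n, P n by exists 0%N; apply/asboolP; exists [::]; rewrite span_nil dimv0.
have ubP n : P n -> (n <= \dim {:V})%N.
  by move=> /asboolP[s [_ <-]]; apply/dimvS/subvf.
case: (ex_maxnP exP ubP) => n /asboolP[s [sS dims]] maxn.
exists <<s>>%VS; split=> [x Sx|W SW]; last first.
  by apply/span_subvP => x /sS /SW.
have le_s : (<<s>> <= <<x :: s>>)%VS by rewrite span_cons addvSr.
suff /eqP -> : (<<s>> == <<x :: s>>)%VS by rewrite memv_span // mem_head.
rewrite eqEdim le_s /= dims; apply: maxn; apply/asboolP.
exists (x :: s); split=> // y; rewrite inE => /orP[/eqP->//|]; exact: sS.
Qed.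

(* The linear span of a possibly infinite set of vectors. *)
Definition spanset (S : set V) : {vspace V} := sval (cid (spanset_exists S)).

Lemma mem_spanset (S : set V) x : S x -> x \in spanset S.
Proof. exact: (svalP (cid (spanset_exists S))).1. Qed.

Lemma spanset_sub (S : set V) (W : {vspace V}) :
  (forall x, S x -> x \in W) -> (spanset S <= W)%VS.
Proof. exact: (svalP (cid (spanset_exists S))).2. Qed.

End SpanSet.

(* U (x) V, given by coordinates in the basis (e_i (x) f_j) attached to the
   library's chosen bases of U and V.  [pure u v] is u (x) v, and [tlift b] is
   the map U (x) V -> W with u (x) v |-> b u v, for a bilinear b. *)
Definition tensor (k : fieldType) (U V : vectType k) : Type :=
  'M[k]_(\dim {:U}, \dim {:V}).

HB.instance Definition _ (k : fieldType) (U V : vectType k) :=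
  Vector.copy (tensor U V) 'M[k]_(\dim {:U}, \dim {:V}).

Section Tensor.
Variable k : fieldType.

Definition pure (U V : vectType k) (u : U) (v : V) : tensor U V :=
  \matrix_(i, j) (coord (vbasis {:U}) i u * coord (vbasis {:V}) j v).

Definition tlift (U V W : vectType k) (b : U -> V -> W) (t : tensor U V) : W :=
  \sum_i \sum_j (t : 'M_(_, _)) i j *: b (vbasis {:U})`_i (vbasis {:V})`_j.

Definition bilin (U V W : vectType k) (b : U -> V -> W) :=
  (forall v, linear (b^~ v)) /\ (forall u, linear (b u)).

Lemma tlift_linear (U V W : vectType k) (b : U -> V -> W) : linear (tlift b).
Proof.
move=> c s t; rewrite /tlift scaler_sumr -big_split /=; apply: eq_bigr => i _.
rewrite scaler_sumr -big_split /=; apply: eq_bigr => j _.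
by rewrite !mxE scalerDl scalerA.
Qed.
HB.instance Definition _ (U V W : vectType k) (b : U -> V -> W) :=
  GRing.isLinear.Build k (tensor U V) W _ (tlift b) (tlift_linear b).

Lemma eq_tlift (U V W : vectType k) (b b' : U -> V -> W) t :
  b =2 b' -> tlift b t = tlift b' t.
Proof. by move=> bb; apply: eq_bigr => i _; apply: eq_bigr => j _; rewrite bb. Qed.

Lemma tlift_fun_linear (U V W : vectType k) (b b' : U -> V -> W) c t :
  tlift (fun u v => c *: b u v + b' u v) t = c *: tlift b t + tlift b' t.
Proof.
rewrite /tlift scaler_sumr -big_split /=; apply: eq_bigr => i _.
rewrite scaler_sumr -big_split /=; apply: eq_bigr => j _.
by rewrite scalerDr !scalerA mulrC.
Qed.

Lemma pure_bilin (U V : vectType k) : bilin (@pure U V).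
Proof.
split=> [v c u u'|u c v v']; apply/matrixP => i j; rewrite !mxE linearP /=.
  by rewrite mulrDl mulrA.
by rewrite mulrDr mulrCA.
Qed.

Lemma bilin_suml (U V W : vectType k) (b : U -> V -> W) : bilin b ->
  forall (I : finType) (c : I -> k) (e : I -> U) v,
  b (\sum_i c i *: e i) v = \sum_i c i *: b (e i) v.
Proof.
move=> [bl _] I c e v.
pose bv := HB.pack_for {linear U -> W} (b^~ v)
  (GRing.isLinear.Build k U W _ (b^~ v) (bl v)).
rewrite -[LHS]/(bv _) linear_sum; apply: eq_bigr => i _.
by rewrite linearZ.
Qed.

Lemma bilin_sumr (U V W : vectType k) (b : U -> V -> W) : bilin b ->
  forall (I : finType) (c : I -> k) u (e : I -> V),
  b u (\sum_i c i *: e i) = \sum_i c i *: b u (e i).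
Proof.
move=> [_ br] I c u e.
pose bu := HB.pack_for {linear V -> W} (b u)
  (GRing.isLinear.Build k V W _ (b u) (br u)).
rewrite -[LHS]/(bu _) linear_sum; apply: eq_bigr => i _.
by rewrite linearZ.
Qed.

Lemma tlift_pure (U V W : vectType k) (b : U -> V -> W) u v :
  bilin b -> tlift b (pure u v) = b u v.
Proof.
move=> bb; rewrite {2}(coord_vbasis (memvf u)) (bilin_suml bb).
apply: eq_bigr => i _; rewrite {2}(coord_vbasis (memvf v)) (bilin_sumr bb).
by rewrite scaler_sumr; apply: eq_bigr => j _; rewrite mxE scalerA.
Qed.

Lemma tensorE (U V : vectType k) (t : tensor U V) : t = tlift (@pure U V) t.
Proof.
have cf (X : vectType k) (i j : 'I_(\dim {:X})) :
    coord (vbasis {:X}) i (vbasis {:X})`_j = (j == i)%:R.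
  by rewrite coord_free ?(basis_free (vbasisP {:X})).
apply/matrixP => a b; rewrite /tlift summxE (bigD1 a) //= summxE (bigD1 b) //=.
rewrite !mxE !cf !eqxx !mulr1 !big1 ?addr0 // => [i ia|j jb].
  by rewrite summxE big1 // => j _; rewrite !mxE cf (negPf ia) mul0r mulr0.
by rewrite !mxE !cf (negPf jb) !mulr0.
Qed.

Lemma tensor_ext (U V W : vectType k) (f g : {linear tensor U V -> W}) :
  (forall u v, f (pure u v) = g (pure u v)) -> f =1 g.
Proof.
move=> fg t; rewrite [t]tensorE /tlift !linear_sum; apply: eq_bigr => i _.
by rewrite !linear_sum; apply: eq_bigr => j _; rewrite !linearZ fg.
Qed.

Lemma tensor_ind (U V : vectType k) (P : tensor U V -> Prop) :
  (forall c s t, P s -> P t -> P (c *: s + t)) -> P 0 ->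
  (forall u v, P (pure u v)) -> forall t, P t.
Proof.
move=> Pl P0 Pp t; rewrite [t]tensorE /tlift.
have PD s u : P s -> P u -> P (s + u).
  by move=> Ps Pu; rewrite -[s]scale1r; apply: Pl.
do 2![elim/big_ind: _ => // ? _].
by rewrite -[_ *: _]addr0; apply: Pl.
Qed.

Definition tmap (U V U' V' : vectType k) (f : U -> U') (g : V -> V') :
  tensor U V -> tensor U' V' := tlift (fun u v => pure (f u) (g v)).

Definition tassoc (U V W : vectType k) :
  tensor (tensor U V) W -> tensor U (tensor V W) :=
  tlift (fun s w => tlift (fun u v => pure u (pure v w)) s).

Definition tens_vspace (U V : vectType k) (A : {vspace U}) (B : {vspace V}) :
    {vspace tensor U V} :=
  spanset [set t | exists u v, [/\ u \in A, v \in B & t = pure u v]]%classic.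

(* The relations of M (x)_A N, for a space A of operators acting on the right
   of M by [ra] and on the left of a subspace N of V by [la]. *)
Definition balance (R M V : vectType k) (A : {vspace R}) (N : {vspace V})
    (ra : M -> R -> M) (la : R -> V -> V) : {vspace tensor M V} :=
  spanset [set t | exists m h n, [/\ h \in A, n \in N &
    t = pure (ra m h) n - pure m (la h n)]]%classic.

(* dim_k (M (x)_A N), as the dimension of (M (x) N) / balance; this requires N
   to be stable under [la]. *)
Definition dim_tensor_over (R M V : vectType k) (A : {vspace R})
    (N : {vspace V}) (ra : M -> R -> M) (la : R -> V -> V) : nat :=
  (\dim (tens_vspace {:M} N) - \dim (balance A N ra la))%N.

End Tensor.

Section TensorAlgebra.
Variables (k : fieldType) (A B : falgType k).

Definition tmul (s t : tensor A B) : tensor A B :=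
  tlift (fun a b => tlift (fun a' b' => pure (a * a') (b * b')) t) s.

Lemma pureDl a a' b : pure (a + a') b = pure a b + pure a' b :> tensor A B.
Proof. by have [h _] := pure_bilin A B; have := h b 1 a a'; rewrite !scale1r. Qed.
Lemma pureDr a b b' : pure a (b + b') = pure a b + pure a b' :> tensor A B.
Proof. by have [_ h] := pure_bilin A B; have := h a 1 b b'; rewrite !scale1r. Qed.

Lemma tmul_linr s : linear (tmul s).
Proof.
move=> c t t'; rewrite /tmul -tlift_fun_linear; apply: eq_tlift => a b.
exact: tlift_linear.
Qed.

Lemma tmul_linl t : linear (tmul^~ t).
Proof. by move=> c s s'; rewrite /tmul tlift_linear. Qed.

Lemma bilin_pureM (a : A) (b : B) :
  bilin (fun a' b' => pure (a * a') (b * b')).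
Proof.
have [bl br] := pure_bilin A B.
by split=> [b' c u v|a' c u v]; rewrite mulrDr -scalerAr ?bl ?br.
Qed.

Lemma bilin_pureMr (a' : A) (b' : B) :
  bilin (fun a b => pure (a * a') (b * b')).
Proof.
have [bl br] := pure_bilin A B.
by split=> [b c u v|a c u v]; rewrite mulrDl -scalerAl ?bl ?br.
Qed.

Lemma tmul_pure a b a' b' :
  tmul (pure a b) (pure a' b') = pure (a * a') (b * b').
Proof.
have h u v := tlift_pure a' b' (bilin_pureM u v).
rewrite /tmul tlift_pure ?h //.
have [bl br] := bilin_pureMr a' b'.
by split=> [v c u u'|u c v v']; rewrite !h ?bl ?br.
Qed.

Lemma tmulDl : left_distributive tmul +%R.
Proof. by move=> s s' t; have := tmul_linl t 1 s s'; rewrite !scale1r. Qed.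
Lemma tmulDr : right_distributive tmul +%R.
Proof. by move=> s t t'; have := tmul_linr s 1 t t'; rewrite !scale1r. Qed.
Lemma tmul0l t : tmul 0 t = 0.
Proof. by apply: (addrI (tmul 0 t)); rewrite -tmulDl !addr0. Qed.
Lemma tmul0r t : tmul t 0 = 0.
Proof. by apply: (addrI (tmul t 0)); rewrite -tmulDr !addr0. Qed.

Lemma tmulA : associative tmul.
Proof.
move=> r s t; elim/tensor_ind: r => [c r r' IH IH'||a b]; last 1 first.
- elim/tensor_ind: s => [c s s' IH IH'||a' b']; last 1 first.
  + elim/tensor_ind: t => [c t t' IH IH'||a'' b'']; last 1 first.
    * by rewrite !tmul_pure !mulrA.
    * by rewrite !tmul_linr IH IH'.
    * by rewrite !tmul0r.
  + by rewrite tmul_linl !tmul_linr tmul_linl IH IH'.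
  + by rewrite tmul0l tmul0r tmul0l.
- by rewrite !tmul_linl IH IH'.
- by rewrite !tmul0l.
Qed.

Lemma tmul1l : left_id (pure 1 1) tmul.
Proof.
move=> t; elim/tensor_ind: t => [c t t' IH IH'||a b].
- by rewrite tmul_linr IH IH'.
- by rewrite tmul0r.
- by rewrite tmul_pure !mul1r.
Qed.

Lemma tmul1r : right_id (pure 1 1) tmul.
Proof.
move=> t; elim/tensor_ind: t => [c t t' IH IH'||a b].
- by rewrite tmul_linl IH IH'.
- by rewrite tmul0l.
- by rewrite tmul_pure !mulr1.
Qed.

Lemma tone_neq0 : pure 1 1 != 0 :> tensor A B.
Proof.
have nz (X : falgType k) : exists i, coord (vbasis {:X}) i 1 != 0.
  apply/existsP; apply: contraT; rewrite negb_exists => /forallP h.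
  have := oner_neq0 X; rewrite (coord_vbasis (memvf (1 : X))) big1 ?eqxx // => i _.
  by move/negPn/eqP: (h i) => ->; rewrite scale0r.
have [[i hi] [j hj]] := (nz A, nz B).
apply/eqP => /matrixP /(_ i j); rewrite !mxE; apply/eqP.
by rewrite mulf_neq0.
Qed.

HB.instance Definition _ := GRing.Zmodule_isNzRing.Build (tensor A B)
  tmulA tmul1l tmul1r tmulDl tmulDr tone_neq0.

Lemma pure1 : pure 1 1 = 1 :> tensor A B. Proof. by []. Qed.

Lemma pureM a b a' b' :
  (pure a b : tensor A B) * pure a' b' = pure (a * a') (b * b').
Proof. exact: tmul_pure. Qed.

End TensorAlgebra.

HB.mixin Record Falgebra_isHopf (k : fieldType) H of Falgebra k H := {
  comul : 'Hom((H : falgType k), tensor H H);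
  counit : 'Hom((H : falgType k), k^o);
  antipode : 'End((H : falgType k));
  comulA : forall h,
    tassoc (tmap comul idfun (comul h)) = tmap idfun comul (comul h);
  counitl : forall h, tlift (fun u v => counit u *: v) (comul h) = h;
  counitr : forall h, tlift (fun u v => counit v *: u) (comul h) = h;
  comul1 : comul 1 = 1;
  comulM : forall g h, comul (g * h) = comul g * comul h;
  counit1 : counit 1 = 1;
  counitM : forall g h, counit (g * h) = counit g * counit h;
  antipodel : forall h, tlift (fun u v => antipode u * v) (comul h) = counit h *: 1;
  antipoder : forall h, tlift (fun u v => u * antipode v) (comul h) = counit h *: 1
}.

#[short(type="hopfType")]
HB.structure Definition Hopf (k : fieldType) :=
  { H of Falgebra_isHopf k H & Falgebra k H }.

Definition hopf_iso (k : fieldType) (H H' : hopfType k) (f : 'AHom(H, H')) :=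
  [/\ bijective f,
      forall h, comul (f h) = tmap f f (comul h),
      forall h, counit (f h) = counit h
    & forall h, antipode (f h) = f (antipode h)].

Definition hopf_isomorphic (k : fieldType) (H H' : hopfType k) :=
  exists f : 'AHom(H, H'), hopf_iso f.

Section Pointed.
Variables (k : fieldType) (H : hopfType k).
Implicit Types (g h a c : H) (C D : {vspace H}).

Definition grouplike g := comul g = pure g g /\ counit g = 1.

Definition subcoalgebra C := (comul @: C <= tens_vspace C C)%VS.

Definition simple_subcoalgebra C :=
  [/\ C != 0%VS, subcoalgebra C
    & forall D, subcoalgebra D -> (D <= C)%VS -> D = 0%VS \/ D = C].

Definition coradical : {vspace H} :=
  spanset [set h | exists2 C, simple_subcoalgebra C & h \in C]%classic.

Definition coradical1 : {vspace H} :=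
  (comul @^-1: (tens_vspace fullv coradical + tens_vspace coradical fullv))%VS.

Definition pointed := forall C, simple_subcoalgebra C -> \dim C = 1%N.

Definition skew_primitive g h c := comul c = pure c g + pure h c.

Definition skew_point a :=
  grouplike a /\ exists2 c, skew_primitive a 1 c & c \notin coradical.

Definition has_rank (t : nat) :=
  pointed /\
  dim_tensor_over coradical coradical1
    (fun (z : k^o) (h : H) => counit h *: z) (fun h m => h * m) = t.+1.

End Pointed.

Section Families.
Variable k : fieldType.

(* The group algebra k[G], as a vector space with basis the [gelt g]. *)
Definition gelt (G : finGroupType) (g : G) : {ffun G -> k^o} :=
  [ffun h => (h == g)%:R].

Definition linear_character (G : finGroupType) (chi : G -> k) :=
  chi 1%g = 1 /\ forall g h, chi (g * h)%g = chi g * chi h.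

(* The r + 1 scalars alpha are indexed by -1, 0, ..., r - 1: alpha_{-1} is kept
   apart from the others. *)
Record datumR := DatumR {
  R_G : finGroupType;
  R_chi : R_G -> k;
  R_a : R_G;
  R_r : nat;
  R_alpha_m1 : k;
  R_alpha : 'I_R_r -> k
}.

(* N is the order of chi a. *)
Definition datumR_valid (p : nat) (R : datumR) (N : nat) :=
  let: DatumR G chi a r alpha_m1 alpha := R in
  let n := (p ^ r * N)%N in
  [/\ a \in 'Z([set: G])%g, linear_character chi, chi a != 1
    & N.-primitive_root (chi a)] /\
  [/\ (a ^+ n)%g = 1%g -> alpha_m1 = 0,
      forall i : 'I_r, alpha i != 0 ->
        (a ^+ (N * (p ^ r - p ^ i)))%g = 1%g /\
        forall g, chi g ^+ (N * (p ^ r - p ^ i)) = 1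
    & alpha_m1 != 0 -> forall g, chi g ^+ (N * p ^ r) = 1].

Record datumF := DatumF {
  F_G : finGroupType;
  F_chi : F_G -> k;
  F_c : F_G -> k;
  F_a : F_G;
  F_alpha_m1 : k;
  F_alpha0 : k
}.

(* The last clause puts chi g in F_p^*, as the image of an m prime to p. *)
Definition datumF_valid (p : nat) (F : datumF) :=
  let: DatumF G chi c a alpha_m1 alpha0 := F in
  [/\ a \in 'Z([set: G])%g, linear_character chi, chi a = 1,
      forall g h, c (h * g)%g = chi g * c h + c g & c a = 0] /\
  [/\ alpha0 = 0 \/ alpha0 = 1,
      alpha0 = 0 -> alpha_m1 = 0,
      alpha0 = 0 -> forall g, c g *: (gelt (a ^+ p)%g - gelt 1%g) = 0
    & alpha0 = 1 -> (a ^+ p)%g = a /\ forall g,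
        (exists2 m : nat, ~~ (p %| m)%N & chi g = m%:R) /\
        (alpha_m1 * (chi g - 1) + c g ^+ p - c g) *: (gelt a - gelt 1%g) = 0].

Definition monomial_basis (A : falgType k) (G : finGroupType) (iota : G -> A)
    (x : A) (n : nat) :=
  basis_of fullv [seq iota gi.1 * x ^+ gi.2 | gi : G * 'I_n].

Definition group_to_algebra (A : falgType k) (G : finGroupType) (iota : G -> A) :=
  iota 1%g = 1 /\ forall g h, iota (g * h)%g = iota g * iota h.

(* The Hopf structure common to H_R and H_F; the coproduct is computed in the
   algebra A (x) A. *)
Definition skew_hopf_structure (A : hopfType k) (G : finGroupType)
    (iota : G -> A) (a : G) (x : A) (n : nat) :=
  forall (g : G) (i : nat), (i < n)%N ->
  [/\ comul (iota g * x ^+ i) =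
        pure (iota g) (iota g) * (pure x (iota a) + pure 1 x) ^+ i,
      counit (iota g * x ^+ i) = (i == 0%N)%:R
    & antipode (iota g * x ^+ i) =
        (- (x * iota a^-1%g)) ^+ i * iota g^-1%g].

(* A is the Hopf algebra H_R: it contains k[G] (iota is injective and the iota g
   are free because of monomial_basis) and x, and its structure is determined by
   the basis, the relations and the formulas for the coalgebra maps. *)
Definition is_HR (p : nat) (R : datumR) (N : nat) (A : hopfType k) :=
  let: DatumR G chi a r alpha_m1 alpha := R in
  let n := (p ^ r * N)%N in
  exists (iota : G -> A) (x : A),
  [/\ group_to_algebra iota,
      monomial_basis iota x n,
      forall g, iota g * x * iota g^-1%g = chi g *: x,
      x ^+ n = alpha_m1 *: (iota (a ^+ n)%g - 1)
               + \sum_(i < r) alpha i *: x ^+ (p ^ i * N)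
    & skew_hopf_structure iota a x n].

Definition is_HF (p : nat) (F : datumF) (A : hopfType k) :=
  let: DatumF G chi c a alpha_m1 alpha0 := F in
  exists (iota : G -> A) (x : A),
  [/\ group_to_algebra iota,
      monomial_basis iota x p,
      forall g, iota g * x * iota g^-1%g = chi g *: x + c g *: (iota a - 1),
      x ^+ p = alpha_m1 *: (iota (a ^+ p)%g - 1) + alpha0 *: x
    & skew_hopf_structure iota a x p].

End Families.

(* Main.v *)
From HB Require Import structures.
Require Import Defs.
From mathcomp Require Import all_boot all_order all_fingroup all_algebra.
From mathcomp Require Import all_solvable all_field.
From mathcomp Require Import boolp ring.

Set Implicit Arguments.
Unset Strict Implicit.
Unset Printing Implicit Defensive.

Import GRing.Theory.
Local Open Scope ring_scope.

(** Write [H0] and [H1] for the first two terms of the coradical filtration, and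
    let [z] be the given eigenvector in [P_{a,1} \ H0].  The Hopf algebra [H] is
    shown to be itself of the form [H_R] or [H_F], with [G] the group of its
    group-like elements, so that the isomorphism is the identity.

    Rank one.  [H1 / H0] is a left Hopf module over [H0], hence is [H0] tensored
    with its coinvariants; since [k (x)_{H0} H1] has dimension 2 and the class of
    [1] in it is nonzero, the coinvariants form a line, spanned by the class of
    [z].  Thus [H1 = H0 + H0 z] ([rank1_coradical1]), and an element of [P_{b,1}]
    is [beta z + c (b - 1)], where [beta = 0] unless [b = a] ([skew_primitiveP]).

    Conjugation.  For [g] in [G], the conjugate of [z] by [g] is in
    [P_{gag^-1,1}] but not in [H0].  So [a] is central and
    [g z g^-1 = chi(g) z + c(g) (a - 1)] for a character [chi] and a cocycle [c]
    ([conj_data_exists]).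

    Powers.  In [H (x) H], [z (x) a] and [1 (x) z] commute up to [q], so that the
    powers of [comul z] are given by the q-binomial formula.  Let [n] be the
    order of [q] if [q != 1], and [p] if [q = 1].  The coefficients of degree [n]
    other than the two extreme ones vanish, so [z^n] is in [P_{a^n,1}] and
    [z^n = beta z + alpha (a^n - 1)] ([skew_primitive_power]).  The coefficients
    [qbin q i 1] with [0 < i < n] do not vanish, which makes the [g z^i] with
    [i < n] linearly independent ([free_monomials_qchar]); they span because [H1]
    generates [H].

    Normal forms.  If [q != 1], that [a] commutes with [G] forces [c = 0], and
    [beta != 0] would give [a^n = a], hence [q = q^n = 1].  If [q = 1] and [k] is
    algebraically closed, then for [beta = 0] a translate [z + l (a - 1)] has
    [p]-th power [0], and for [beta != 0] a multiple of [z] has [beta = 1].  The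
    conditions on the datum come from conjugating the relation for [z^n] by
    [g]. *)

(** * Linear maps on tensors *)

Section SpanSetMaps.
Variables (k : fieldType) (V W : vectType k).

Lemma spanset_ind (S : classical_sets.set V) (f : {linear V -> W}) (A : {vspace W}) :
  (forall x, S x -> f x \in A) -> {in spanset S, forall x, f x \in A}.
Proof.
move=> SA x; have /subvP sub : (spanset S <= linfun f @^-1: A)%VS.
  by apply: spanset_sub => y Sy; rewrite -memv_preim lfunE /=; apply: SA.
by move/sub; rewrite -memv_preim lfunE.
Qed.

End SpanSetMaps.

Section TensorMaps.
Variable k : fieldType.
Implicit Types U V W X : vectType k.

Lemma pureZl U V c (u : U) (v : V) : pure (c *: u) v = c *: pure u v.
Proof. by apply/matrixP => i j; rewrite !mxE linearZ /= mulrA. Qed.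

Lemma pureZr U V c (u : U) (v : V) : pure u (c *: v) = c *: pure u v.
Proof. by apply/matrixP => i j; rewrite !mxE linearZ /= mulrCA. Qed.

Lemma pure_addl U V (u u' : U) (v : V) : pure (u + u') v = pure u v + pure u' v.
Proof. by apply/matrixP => i j; rewrite !mxE linearD /= mulrDl. Qed.

Lemma pure_addr U V (u : U) (v v' : V) : pure u (v + v') = pure u v + pure u v'.
Proof. by apply/matrixP => i j; rewrite !mxE linearD /= mulrDr. Qed.

HB.instance Definition _ U V (u : U) := GRing.isLinear.Build k V (tensor U V) _
  (@pure k U V u) ((pure_bilin U V).2 u).

Lemma pureNr U V (u : U) (v : V) : pure u (- v) = - pure u v.
Proof. by rewrite -scaleN1r pureZr scaleN1r. Qed.

Lemma pureNl U V (u : U) (v : V) : pure (- u) v = - pure u v.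
Proof. by rewrite -scaleN1r pureZl scaleN1r. Qed.

Lemma bilin_pure_comp U V U' V' (f : {linear U -> U'}) (g : {linear V -> V'}) :
  bilin (fun u v => pure (f u) (g v)).
Proof.
by split=> [v c x y|u c x y]; rewrite linearP ?pure_addl ?pureZl ?pure_addr ?pureZr.
Qed.

Lemma tmap_pure U V U' V' (f : {linear U -> U'}) (g : {linear V -> V'}) u v :
  tmap f g (pure u v) = pure (f u) (g v).
Proof. by rewrite /tmap (tlift_pure _ _ (bilin_pure_comp f g)). Qed.

HB.instance Definition _ U V U' V' (f : U -> U') (g : V -> V') :=
  GRing.Linear.copy (tmap f g) (tlift (fun u v => pure (f u) (g v))).

Lemma bilin_pure_pure U V W (w : W) :
  bilin (fun (u : U) (v : V) => pure u (pure v w)).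
Proof.
split=> [v c x y|u c x y]; first by rewrite pure_addl pureZl.
by rewrite pure_addl pureZl pure_addr pureZr.
Qed.

HB.instance Definition _ U V W := GRing.Linear.copy (@tassoc k U V W)
  (tlift (fun s w => tlift (fun u v => pure u (pure v w)) s)).

Lemma tassoc_pure_tensor U V W (s : tensor U V) (w : W) :
  tassoc (pure s w) = tlift (fun u v => pure u (pure v w)) s.
Proof.
rewrite /tassoc tlift_pure //; split=> [{}w c x y|{}s c x y].
  exact: tlift_linear.
rewrite -tlift_fun_linear; apply: eq_tlift => u v.
by rewrite pure_addr pureZr pure_addr pureZr.
Qed.

Lemma tassoc_pure U V W (u : U) (v : V) (w : W) :
  tassoc (pure (pure u v) w) = pure u (pure v w).
Proof. by rewrite tassoc_pure_tensor tlift_pure //; apply: bilin_pure_pure. Qed.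

Definition contractl U V (f : U -> k^o) : tensor U V -> V :=
  tlift (fun u v => f u *: v).

HB.instance Definition _ U V (f : U -> k^o) :=
  GRing.Linear.copy (@contractl U V f) (tlift (fun u v => f u *: v)).

Lemma contractl_pure U V (f : {linear U -> k^o}) u (v : V) :
  contractl f (pure u v) = f u *: v.
Proof.
rewrite /contractl tlift_pure //.
split=> [w c x y|w c x y]; last by rewrite scalerDr !scalerA mulrC.
by rewrite linearP scalerDl scalerA.
Qed.

Lemma contractl_tmap U V V' (f : {linear U -> k^o}) (g : {linear V -> V'}) t :
  contractl f (tmap idfun g t) = g (contractl f t).
Proof.
pose F : {linear tensor U V -> V'} := contractl f \o tmap idfun g.
pose G : {linear tensor U V -> V'} := g \o contractl f.
apply: (@tensor_ext _ _ _ _ F G) => u v /=.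
by rewrite tmap_pure /= !contractl_pure linearZ.
Qed.

Lemma memt_pure U V (A : {vspace U}) (B : {vspace V}) u v :
  u \in A -> v \in B -> pure u v \in tens_vspace A B.
Proof. by move=> uA vB; apply: mem_spanset; exists u, v. Qed.

Lemma tens_vspace_ind U V W (A : {vspace U}) (B : {vspace V})
    (f : {linear tensor U V -> W}) (C : {vspace W}) :
  (forall u v, u \in A -> v \in B -> f (pure u v) \in C) ->
  {in tens_vspace A B, forall t, f t \in C}.
Proof. by move=> fC; apply: spanset_ind => _ [u [v [uA vB ->]]]; apply: fC. Qed.

Lemma tens_vspaceS U V (A A' : {vspace U}) (B B' : {vspace V}) :
  (A <= A')%VS -> (B <= B')%VS -> (tens_vspace A B <= tens_vspace A' B')%VS.
Proof.
move=> /subvP sA /subvP sB; apply/subvP.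
by apply: (@tens_vspace_ind U V _ A B idfun) => u v /sA uA /sB vB; apply: memt_pure.
Qed.

Lemma pure_eq0 U V (u : U) (v : V) : pure u v = 0 -> u = 0 \/ v = 0.
Proof.
move=> uv; case: (eqVneq u 0) => [|u0]; [by left|right].
have [i ui] : exists i, coord (vbasis {:U}) i u != 0.
  apply/existsP; apply: contraNT u0; rewrite negb_exists => /forallP h.
  rewrite (coord_vbasis (memvf u)) big1 // => i _.
  by move/negPn/eqP: (h i) => ->; rewrite scale0r.
pose f : {linear U -> k^o} := coord (vbasis {:U}) i.
have := contractl_pure f u v; rewrite uv linear0 => /esym/eqP.
by rewrite scaler_eq0 (negPf ui) => /eqP.
Qed.

End TensorMaps.

Section TensorRing.
Variables (k : fieldType) (A B : falgType k).
Implicit Types (s t : tensor A B).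

Lemma tscalerAr c s t : c *: (s * t) = s * (c *: t).
Proof.
by have := tmul_linr s c t 0; rewrite !addr0 -[tmul s 0]/(s * 0) mulr0 addr0.
Qed.

HB.instance Definition _ s :=
  GRing.isLinear.Build k (tensor A B) (tensor A B) _ (tmul s) (tmul_linr s).

End TensorRing.

(** * Convolution and group-like elements *)

Section Convolution.
Variables (k : fieldType) (H : hopfType k).
Implicit Types (f g : {linear H -> H}) (u v h : H).

Lemma bilin_mul f g : bilin (fun u v => f u * g v).
Proof.
split=> [v c x y|u c x y]; first by rewrite linearP mulrDl -scalerAl.
by rewrite linearP mulrDr -scalerAr.
Qed.

(** The composite of [conv f g] with the coproduct is the convolution product
    of [f] and [g]. *)
Definition conv (f g : H -> H) : tensor H H -> H := tlift (fun u v => f u * g v).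

HB.instance Definition _ (f g : H -> H) :=
  GRing.Linear.copy (conv f g) (tlift (fun u v => f u * g v)).

Lemma conv_pure f g u v : conv f g (pure u v) = f u * g v.
Proof. by rewrite /conv tlift_pure //; apply: bilin_mul. Qed.

Lemma conv_antipodel h : conv (@antipode k H) idfun (comul h) = (counit h : k) *: 1.
Proof. exact: antipodel. Qed.

Lemma conv_antipoder h : conv idfun (@antipode k H) (comul h) = (counit h : k) *: 1.
Proof. exact: antipoder. Qed.

Lemma contractl_counit h : contractl (@counit k H) (comul h) = h.
Proof. exact: counitl. Qed.

(** The antipode is a left convolution inverse of the identity, so
    [f = S * (id * f) = 0].  Identities for the antipode are proved by
    convolving both sides with the identity. *)
Lemma conv_id_inj f :
  (forall h, conv idfun f (comul h) = 0) -> forall h, f h = 0.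
Proof.
move=> f0 h.
pose G : {linear tensor H H -> H} := conv idfun f.
pose F : {linear tensor H (tensor H H) -> H} :=
  tlift (fun u (t : tensor H H) => antipode u * G t).
have FE u t : F (pure u t) = antipode u * G t.
  rewrite /F /= tlift_pure //.
  split=> [v c x y|v c x y]; first by rewrite linearP mulrDl -scalerAl.
  by rewrite linearP mulrDr -scalerAr.
have right : F (tmap idfun comul (comul h)) = 0.
  pose L : {linear tensor H H -> H} := F \o tmap idfun comul.
  elim/tensor_ind: (comul h) => [c s t s0 t0||u v].
  - by rewrite -[LHS]/(L _) linearP /= s0 t0 scaler0 addr0.
  - by rewrite -[LHS]/(L _) linear0.
  - by rewrite tmap_pure FE /= f0 mulr0.
have assocF u v w : F (tassoc (pure (pure u v) w)) = antipode u * v * f w.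
  by rewrite tassoc_pure FE /G /= conv_pure mulrA.
have assocF2 s w :
    F (tassoc (pure s w)) = conv (@antipode k H) idfun s * f w.
  elim/tensor_ind: s => [c s t IHs IHt||u v].
  - rewrite pure_addl pureZl [tassoc _]linearP [F _]linearP IHs IHt.
    by rewrite [conv _ _ (_ + _)]linearP mulrDl scalerAl.
  - by rewrite -(scale0r 0) pureZl scale0r !linear0 mul0r.
  - by rewrite assocF conv_pure.
have left t : F (tassoc (tmap comul idfun t)) = f (contractl (@counit k H) t).
  elim/tensor_ind: t => [c s t IHs IHt||u v].
  - rewrite [tmap _ _ _]linearP [tassoc _]linearP [F _]linearP IHs IHt.
    by rewrite [in RHS]linearP [RHS]linearP.
  - by rewrite !linear0.
  - rewrite tmap_pure assocF2 conv_antipodel contractl_pure linearZ /=.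
    by rewrite -scalerAl mul1r.
by rewrite -[h in LHS]contractl_counit -left comulA right.
Qed.

End Convolution.

Section Grouplikes.
Variables (k : fieldType) (H : hopfType k).
Implicit Types (g h a z : H).

Lemma grouplike1 : grouplike (1 : H).
Proof. by split; rewrite ?comul1 ?counit1. Qed.

Lemma grouplikeM g h : grouplike g -> grouplike h -> grouplike (g * h).
Proof.
by move=> [Dg eg] [Dh eh]; split; rewrite ?comulM ?counitM ?Dg ?Dh ?pureM // eg eh mulr1.
Qed.

Lemma grouplike_antipode g : grouplike g ->
  antipode g * g = 1 /\ g * antipode g = 1.
Proof.
move=> [Dg eg]; have := conv_antipodel g; have := conv_antipoder g.
by rewrite Dg !conv_pure eg !scale1r.
Qed.

Lemma grouplike_unit g : grouplike g -> g \is a GRing.unit.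
Proof. by move=> /grouplike_antipode[l r]; apply/unitrP; exists (antipode g). Qed.

Lemma antipode_grouplike g : grouplike g -> antipode g = g^-1.
Proof.
move=> gg; have [l _] := grouplike_antipode gg.
by apply: (mulIr (grouplike_unit gg)); rewrite l mulVr ?grouplike_unit.
Qed.

Lemma grouplikeV g : grouplike g -> grouplike g^-1.
Proof.
move=> gg; have [Dg eg] := gg; have ug := grouplike_unit gg; split.
  have := comulM g^-1 g; rewrite mulVr // comul1 Dg => /(congr1 (fun t => t * pure g^-1 g^-1)).
  by rewrite mul1r -mulrA pureM divrr // pure1 mulr1.
by have := counitM g^-1 g; rewrite mulVr // counit1 eg mulr1.
Qed.

Lemma grouplike_neq0 g : grouplike g -> g != 0.
Proof. by move=> /grouplike_unit; apply: contraTneq => ->; rewrite unitr0. Qed.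

(** If [g = sum_i c_i s_i] with the [s_i] free, then contracting
    [comul g = g (x) g] by the [i]-th coordinate form gives
    [c_i s_i = c_i g]. *)
Lemma free_grouplikes (s : seq H) :
  uniq s -> (forall g, g \in s -> grouplike g) -> free s.
Proof.
elim: s => [|g s IH] /=; first by rewrite nil_free.
move=> /andP[gs us] gl; rewrite free_cons; have fs: free s.
  by apply: IH => // h hs; apply: gl; rewrite inE hs orbT.
rewrite fs andbT; apply/negP => g_span.
have gg : grouplike g by apply: gl; rewrite mem_head.
have gE : g = \sum_(i < size s) coord (in_tuple s) i g *: s`_i.
  exact: (coord_span (X := in_tuple s) g_span).
pose d i : {linear H -> k^o} := coord (in_tuple s) i.
have dE i : (d i g : k) *: g = (d i g : k) *: s`_i.
  rewrite -[LHS](contractl_pure (d i)) -gg.1 [X in comul X]gE linear_sum linear_sum /=.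
  rewrite (bigD1 i) //= big1 => [|j ji].
    rewrite linearZ linearZ /= (gl s`_i _).1 ?inE ?mem_nth ?orbT //.
    by rewrite contractl_pure /d /= coord_free // eqxx scale1r addr0.
  rewrite linearZ linearZ /= (gl s`_j _).1 ?inE ?mem_nth ?orbT //.
  by rewrite contractl_pure /d /= coord_free // (negPf ji) scale0r scaler0.
have d0 i : d i g = 0.
  apply/eqP; apply: contraNT gs => di.
  have /(congr1 (fun x => (d i g : k)^-1 *: x)) := dE i.
  by rewrite !scalerA mulVf // !scale1r => ->; rewrite mem_nth.
have := grouplike_neq0 gg; rewrite {1}gE big1 ?eqxx // => i _.
by rewrite -[coord _ _ _]/(d i g) d0 scale0r.
Qed.

(** Group-like elements are independent, so a duplicate-free list of them has at
    most [dim H] entries, and a longest one contains them all. *)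
Lemma grouplike_list_exists : exists s : seq H,
  forall g, (g \in s) <-> grouplike g.
Proof.
pose P n := `[< exists s : seq H,
  [/\ uniq s, forall g, g \in s -> grouplike g & size s = n] >].
have exP : exists n, P n by exists 0%N; apply/asboolP; exists [::].
have ubP n : P n -> (n <= \dim {:H})%N.
  move=> /asboolP[s [us gl <-]].
  have /eqP <- := free_grouplikes us gl; exact/dimvS/subvf.
case: (ex_maxnP exP ubP) => n /asboolP[s [us gl sn]] maxn.
exists s => g; split=> [/gl//|gg]; apply: contraT => gs.
suff : (size (g :: s) <= n)%N by rewrite /= sn ltnn.
apply: maxn; apply/asboolP; exists (g :: s); split=> //=; first by rewrite gs.
by move=> h; rewrite inE => /orP[/eqP->|/gl].
Qed.

Definition grouplike_list : seq H := sval (cid grouplike_list_exists).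

Lemma grouplike_listP g : g \in grouplike_list <-> grouplike g.
Proof. exact: svalP (cid grouplike_list_exists) g. Qed.

Definition grp : Type := seq_sub grouplike_list.

End Grouplikes.

HB.instance Definition _ (k : fieldType) (H : hopfType k) :=
  SubFinite.copy (grp H) (seq_sub (grouplike_list H)).

Section Group.
Variables (k : fieldType) (H : hopfType k).
Implicit Types x y : grp H.

Lemma grpP x : grouplike (val x).
Proof. exact/grouplike_listP/(valP x). Qed.

Definition grp_of (g : H) (gg : grouplike g) : grp H :=
  SeqSub ((grouplike_listP g).2 gg).

Definition grp_mul x y : grp H := grp_of (grouplikeM (grpP x) (grpP y)).
Definition grp_one : grp H := grp_of (grouplike1 H).
Definition grp_inv x : grp H := grp_of (grouplikeV (grpP x)).

Fact grp_mulA : associative grp_mul.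
Proof. by move=> x y z; apply: val_inj; rewrite /= mulrA. Qed.
Fact grp_mul1 : left_id grp_one grp_mul.
Proof. by move=> x; apply: val_inj; rewrite /= mul1r. Qed.
Fact grp_mulV : left_inverse grp_one grp_inv grp_mul.
Proof. by move=> x; apply: val_inj; rewrite /= mulVr // grouplike_unit //; apply: grpP. Qed.

HB.instance Definition _ := Finite_isGroup.Build (grp H) grp_mulA grp_mul1 grp_mulV.

Lemma val_grpM x y : val (x * y)%g = val x * val y. Proof. by []. Qed.
Lemma val_grp1 : val (1%g : grp H) = 1. Proof. by []. Qed.
Lemma val_grpV x : val (x^-1)%g = (val x)^-1. Proof. by []. Qed.
Lemma val_grpX x i : val (x ^+ i)%g = val x ^+ i.
Proof. by elim: i => [|i IH]; rewrite ?expr0 // expgS exprS -IH. Qed.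

Lemma grp_unit x : val x \is a GRing.unit.
Proof. exact: grouplike_unit (grpP x). Qed.

End Group.

(** * Finite families of vectors *)

Section Families.
Variables (k : fieldType) (V : vectType k) (T : finType) (f : T -> V).

Lemma nth_image_rank (x : T) : [seq f x | x : T]`_(enum_rank x) = f x.
Proof. by rewrite nth_image enum_rankK. Qed.

Lemma free_dual : free [seq f x | x : T] ->
  exists d : T -> {linear V -> k^o}, forall x y, d x (f y) = (x == y)%:R.
Proof.
move=> fr; exists (fun x => coord (image_tuple f T) (enum_rank x)) => x y.
rewrite -(nth_image_rank y) -(inj_eq enum_rank_inj) eq_sym.
exact: (coord_free (X := image_tuple f T)).
Qed.

Lemma free_imageP : (forall c : T -> k, \sum_x c x *: f x = 0 -> forall x, c x = 0) ->
  free [seq f x | x : T].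
Proof.
move=> h; rewrite -[[seq f x | x : T]]/(tval (image_tuple f T)); apply/freeP => c c0 i.
rewrite -(enum_valK i); apply: (h (fun x => c (enum_rank x))).
rewrite (reindex (@enum_val T T)) /=; last by apply: onW_bij; apply: enum_val_bij.
by rewrite -[RHS]c0; apply: eq_bigr => j _; rewrite enum_valK nth_image.
Qed.

Lemma span_imageP v : v \in <<[seq f x | x : T]>>%VS ->
  exists c : T -> k, v = \sum_x c x *: f x.
Proof.
move=> /(coord_span (X := image_tuple f T)) vE.
exists (fun x => coord (image_tuple f T) (enum_rank x) v).
rewrite {1}vE (reindex enum_rank) /=; last by apply: onW_bij; apply: enum_rank_bij.
by apply: eq_bigr => x _; rewrite nth_image_rank.
Qed.

Lemma mem_span_image x : f x \in <<[seq f x | x : T]>>%VS.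
Proof. exact/memv_span/image_f. Qed.

End Families.

Lemma dimv_line_add (k : fieldType) (V : vectType k) (v : V) (U : {vspace V}) :
  v \notin U -> \dim (<[v]> + U)%VS = (\dim U).+1.
Proof.
move=> vU; have v0 : v != 0 by apply: contraNneq vU => ->; rewrite mem0v.
have cap0 : (<[v]> :&: U = 0)%VS.
  apply/eqP; rewrite -subv0; apply/subvP => x /memv_capP[/vlineP[c ->] cvU].
  rewrite memv0; case: (eqVneq c 0) => [->|c0]; first by rewrite scale0r.
  by rewrite -(scale1r v) -(mulVf c0) -scalerA memvZ in vU.
by rewrite dimv_disjoint_sum // dim_vline v0.
Qed.

(** * The coradical of a pointed Hopf algebra *)

Section Coradical.
Variables (k : fieldType) (H : hopfType k).
Implicit Types (g h u v m w z : H) (x y : grp H).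
Notation H0 := (coradical H).

Lemma grouplike_coradical g : grouplike g -> g \in H0.
Proof.
move=> gg; apply: mem_spanset; exists <[g]>%VS; last exact: memv_line.
split; first by rewrite -dimv_eq0 dim_vline grouplike_neq0.
  by rewrite /subcoalgebra limg_line -memvE gg.1; apply: memt_pure; apply: memv_line.
move=> D _ sDg; have := dimvS sDg; rewrite dim_vline grouplike_neq0 //=.
case: (posnP (\dim D)) => [/eqP|D0 D1]; first by rewrite dimv_eq0 => /eqP; left.
by right; apply/eqP; rewrite eqEdim sDg dim_vline grouplike_neq0.
Qed.

Lemma grp_coradical x : val x \in H0.
Proof. exact: grouplike_coradical (grpP x). Qed.

Lemma free_grp : free [seq val x | x : grp H].
Proof.
apply: free_grouplikes => [|g /imageP[x _ ->]]; last exact: grpP.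
by rewrite map_inj_uniq ?enum_uniq //; apply: val_inj.
Qed.

Hypothesis pt : pointed H.

(** A one-dimensional subcoalgebra is spanned by a group-like element: if
    [comul c] is a multiple [l] of [c (x) c], then [l c] is group-like. *)
Lemma coradical_span : H0 = <<[seq val x | x : grp H]>>%VS.
Proof.
apply/eqP; rewrite eqEsubv; apply/andP; split; last first.
  by apply/span_subvP => _ /imageP[x _ ->]; apply: grp_coradical.
apply: spanset_sub => h [C sC hC]; have [C0 subC _] := sC.
have dC := pt sC; pose c := vpick C.
have c0 : c != 0 by rewrite vpick0.
have CE : C = <[c]>%VS.
  by apply/eqP; rewrite eq_sym eqEdim -memvE memv_pick dim_vline c0 dC.
have [l Dc] : exists l, comul c = l *: pure c c.
  apply/vlineP; have : comul c \in tens_vspace C C.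
    by apply: (subvP subC); rewrite memv_img // memv_pick.
  rewrite CE; apply: (@tens_vspace_ind _ _ _ _ _ _ idfun) => _ _ /vlineP[i ->] /vlineP[j ->].
  by rewrite /= pureZl pureZr !memvZ // memv_line.
have lc : l * counit c = 1.
  have := contractl_counit c; rewrite Dc linearZ /= contractl_pure scalerA => /eqP.
  rewrite -subr_eq0 -[X in _ - X]scale1r -scalerBl scaler_eq0 (negPf c0) orbF subr_eq0.
  by move/eqP.
have gl : grouplike (l *: c).
  by split; rewrite linearZ /= ?lc // Dc pureZl pureZr.
have l0 : l != 0 by apply: contraPneq lc => ->; rewrite mul0r; apply/eqP; rewrite eq_sym oner_eq0.
move: hC; rewrite CE => /vlineP[i ->].
rewrite -[c]scale1r -(mulVf l0) -scalerA; do 2!apply: memvZ.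
exact: (mem_span_image (fun x : grp H => val x) (grp_of gl)).
Qed.

Lemma coradicalP h : h \in H0 -> exists c : grp H -> k, h = \sum_x c x *: val x.
Proof. by rewrite coradical_span; apply: span_imageP. Qed.

Lemma coradical_ind (P : H -> Prop) :
  (forall c u v, P u -> P v -> P (c *: u + v)) -> P 0 -> (forall x, P (val x)) ->
  forall h, h \in H0 -> P h.
Proof.
move=> Plin P0 Pval h /coradicalP[c ->].
elim/big_rec: _ => // x u _ Pu; exact: Plin.
Qed.

Lemma coradical_1 : 1 \in H0.
Proof. exact/grouplike_coradical/grouplike1. Qed.

Lemma grpB1_coradical x : val x - 1 \in H0.
Proof. by rewrite memvB ?grp_coradical ?coradical_1. Qed.

Lemma coradicalM u v : u \in H0 -> v \in H0 -> u * v \in H0.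
Proof.
move=> + vH0; elim/coradical_ind: u / => [c u u' uH uH'||x].
- by rewrite mulrDl -scalerAl memvD // memvZ.
- by rewrite mul0r mem0v.
- elim/coradical_ind: v / vH0 => [c v v' vH vH'||y].
  + by rewrite mulrDr -scalerAr memvD // memvZ.
  + by rewrite mulr0 mem0v.
  + by rewrite -val_grpM grp_coradical.
Qed.

Lemma coradical_comul h : h \in H0 -> comul h \in tens_vspace H0 H0.
Proof.
elim/coradical_ind => [c u v uH vH||x].
- by rewrite linearP memvD // memvZ.
- by rewrite linear0 mem0v.
- by rewrite (grpP x).1 memt_pure // grp_coradical.
Qed.

Lemma coradical_antipode h : h \in H0 -> antipode h \in H0.
Proof.
elim/coradical_ind => [c u v uH vH||x].
- by rewrite linearP memvD // memvZ.
- by rewrite linear0 mem0v.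
- by rewrite (antipode_grouplike (grpP x)) -val_grpV grp_coradical.
Qed.

End Coradical.

(** * Coinvariants of [H1 / H0] *)

Section Coinvariants.
Variables (k : fieldType) (H : hopfType k).
Implicit Types (g h u v m w z : H) (x y : grp H).
Notation H0 := (coradical H).

(** [H (x) H0], the kernel of [H (x) H -> H (x) (H / H0)]. *)
Definition rightH0 : {vspace tensor H H} := tens_vspace fullv H0.
Definition leftH0 : {vspace tensor H H} := tens_vspace H0 fullv.

(** The coproduct makes [H1 / H0] a left [H0]-comodule, that is, a space graded
    by the group-like elements.  These are the elements whose class is
    homogeneous of degree [g]; for [g = 1] the class is a coinvariant. *)
Definition homogeneous g w := comul w - pure g w \in rightH0.

Hypothesis pt : pointed H.

(** The map [m |-> S(m_1) m_2] that projects a Hopf module over [H0] on its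
    coinvariants needs [m_1] in [H0].  Here [m_1] ranges over [H], so it is first
    projected to [H0]; modulo [H0] the choice of a projection is immaterial for
    [m] in [H1]. *)
Definition twist : tensor H H -> H := conv (@antipode k H \o projv H0) idfun.
HB.instance Definition _ := GRing.Linear.copy twist
  (conv (@antipode k H \o projv H0) idfun).

Lemma twist_pure u v : twist (pure u v) = antipode (projv H0 u) * v.
Proof. exact: conv_pure. Qed.

Lemma twistP c (s t : tensor H H) : twist (c *: s + t) = c *: twist s + twist t.
Proof. exact: linearP. Qed.

Lemma twist_rightH0 : {in rightH0, forall t, twist t \in H0}.
Proof.
apply: (tens_vspace_ind (f := twist)) => u v _ vH; rewrite /= twist_pure.
by apply: coradicalM => //; apply: coradical_antipode => //; apply: memv_proj.
Qed.

Lemma twist_pure_grp x v : twist (pure (val x) v) = val x^-1%g * v.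
Proof.
by rewrite twist_pure projv_id ?grp_coradical // (antipode_grouplike (grpP x)).
Qed.

Lemma twist_homogeneous1 w : homogeneous 1 w -> twist (comul w) - w \in H0.
Proof.
move/twist_rightH0; rewrite linearB /= -val_grp1 twist_pure_grp.
by rewrite val_grpV val_grp1 invr1 mul1r.
Qed.

Lemma rightH0_mul x : {in rightH0, forall t, pure (val x) (val x) * t \in rightH0}.
Proof.
apply: (@tens_vspace_ind _ _ _ _ _ _ (tmul _)) => u v _ vH /=.
by rewrite tmul_pure memt_pure ?memvf // coradicalM // grp_coradical.
Qed.

Lemma leftH0_mul x : {in leftH0, forall t, pure (val x) (val x) * t \in leftH0}.
Proof.
apply: (@tens_vspace_ind _ _ _ _ _ _ (tmul _)) => u v uH _ /=.
by rewrite tmul_pure memt_pure ?memvf // coradicalM // grp_coradical.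
Qed.

Lemma leftH0_ind (W : vectType k) (f : {linear tensor H H -> W}) (C : {vspace W}) :
  (forall x v, f (pure (val x) v) \in C) -> {in leftH0, forall t, f t \in C}.
Proof.
move=> fC; apply: tens_vspace_ind => u v + _; elim/(coradical_ind pt) => [c s t sC tC||//].
- by rewrite pure_addl pureZl linearP memvD // memvZ.
- by rewrite -(scale0r 0) pureZl scale0r linear0 mem0v.
Qed.

Lemma coradical1P m : m \in coradical1 H ->
  exists r l, [/\ r \in rightH0, l \in leftH0 & comul m = r + l].
Proof. by rewrite -memv_preim => /memv_addP[r rR [l lL ->]]; exists r, l. Qed.

Lemma coradical1I m r l : r \in rightH0 -> l \in leftH0 -> comul m = r + l ->
  m \in coradical1 H.
Proof. by move=> rR lL Dm; rewrite -memv_preim Dm memv_add. Qed.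

Lemma coradical1M h m : h \in H0 -> m \in coradical1 H -> h * m \in coradical1 H.
Proof.
move=> + /coradical1P[r [l [rR lL Dm]]]; elim/(coradical_ind pt) => [c u v uC vC||x].
- by rewrite mulrDl -scalerAl memvD // memvZ.
- by rewrite mul0r mem0v.
- apply: (coradical1I (rightH0_mul x rR) (leftH0_mul x lL)).
  by rewrite comulM Dm (grpP x).1 mulrDr.
Qed.

Lemma homogeneous_coradical1 x w : homogeneous (val x) w -> w \in coradical1 H.
Proof.
move=> hw; apply: (@coradical1I _ (comul w - pure (val x) w) (pure (val x) w)) => //.
  by rewrite memt_pure ?memvf ?grp_coradical.
by rewrite subrK.
Qed.

Lemma homogeneous_mul x y w :
  homogeneous (val y) w -> homogeneous (val (x * y)%g) (val x * w).
Proof.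
rewrite /homogeneous => /(rightH0_mul x).
by rewrite mulrBr comulM (grpP x).1 pureM.
Qed.

(** If [h] is group-like then [S(h m_1) h m_2 = S(m_1) h^-1 h m_2]: modulo [H0]
    the projection on coinvariants is invariant under translation by [h], so it
    factors through [H1 / (H0^+ H1)]. *)
Lemma twist_translate h m : h \in H0 -> m \in coradical1 H ->
  (counit h : k) *: twist (comul m) - twist (comul (h * m)) \in H0.
Proof.
move=> + /coradical1P[r [l [rR lL Dm]]]; elim/(coradical_ind pt) => [c u v uC vC||x].
- rewrite linearP /= scalerDl -scalerA mulrDl -scalerAl.
  rewrite [comul (_ + _)]linearP twistP /=.
  by rewrite opprD addrACA -scalerBr memvD // memvZ.
- by rewrite mul0r !linear0 scale0r addr0 mem0v.
- rewrite (grpP x).2 scale1r comulM (grpP x).1 Dm mulrDr !linearD /= addrACA.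
  apply: memvD; first by rewrite memvB // twist_rightH0 // rightH0_mul.
  pose f : {linear tensor H H -> H} := twist \- (twist \o tmul (pure (val x) (val x))).
  apply: (@leftH0_ind _ f) lL => y v; rewrite /f /= tmul_pure -val_grpM.
  by rewrite !twist_pure_grp mulrA -val_grpM invMg mulgKV subrr mem0v.
Qed.

(** The grading of [H1 / H0]: the component [w x] is the contraction of
    [comul m] by the coordinate form of [x] on the left leg.  It is homogeneous
    by coassociativity, and the sum is [m] modulo [H0] by the counit law. *)
Lemma coradical1_homogeneous m : m \in coradical1 H ->
  exists w : grp H -> H, (forall x, homogeneous (val x) (w x)) /\
    m - \sum_x w x \in H0.
Proof.
move=> /coradical1P[r [l [rR lL Dm]]].
have [d dE] := free_dual (free_grp H).
pose contr x : {linear tensor H H -> H} := contractl (d x).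
exists (fun x => contr x (comul m)); split=> [x|]; last first.
  (* the difference of the two sides, as a linear function of [comul m] *)
  pose f := (linfun (contractl (V := H) (@counit k H)) - \sum_x linfun (contr x))%R.
  have fE t : f t = contractl (@counit k H) t - \sum_x contr x t.
    rewrite /f add_lfunE opp_lfunE sum_lfunE lfunE /=.
    by congr (_ - _); apply: eq_bigr => x _; rewrite lfunE.
  rewrite -{1}[m]contractl_counit -fE Dm linearD memvD //.
    move: rR; apply: (tens_vspace_ind (f := f)) => u v _ vH /=.
    rewrite fE contractl_pure memvB ?memvZ // memv_suml // => x _.
    by rewrite /contr /= contractl_pure memvZ.
  move: lL; apply: (leftH0_ind (f := f)) => x v /=.
  rewrite fE contractl_pure /= (grpP x).2 (bigD1 x) //= big1 => [|y /negPf yx].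
    by rewrite /contr /= contractl_pure dE eqxx !scale1r addr0 subrr mem0v.
  by rewrite /contr /= contractl_pure dE yx scale0r.
pose f : {linear tensor H H -> tensor H H} :=
  (contractl (V := tensor H H) (d x) \o (tassoc (W := H) \o tmap comul idfun)).
have fE : f (comul m) = comul (contr x (comul m)).
  by rewrite /f /= comulA contractl_tmap.
(* [f' (comul m)] is the defect of homogeneity; it is checked on both summands
   of [rightH0 + leftH0] *)
pose f' : {linear tensor H H -> tensor H H} := f \- (pure (val x) \o contr x).
rewrite /homogeneous -fE -[_ - _]/(f' (comul m)) Dm linearD memvD //.
  move: rR; apply: (tens_vspace_ind (f := f')) => u v _ vH.
  rewrite /f' /f /contr /= tmap_pure tassoc_pure_tensor contractl_pure.
  apply: memvB; last by rewrite memt_pure ?memvf // memvZ.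
  suff h t : contractl (V := tensor H H) (d x)
      (tlift (fun a b : H => pure a (pure b v)) t) \in rightH0 by exact: h.
  elim/tensor_ind: t => [c s t sR tR||a b].
  - by rewrite tlift_linear /contractl tlift_linear memvD // memvZ.
  - by rewrite !linear0 mem0v.
  - rewrite tlift_pure; last exact: bilin_pure_pure.
    by rewrite contractl_pure memvZ // memt_pure ?memvf.
move: lL; apply: (leftH0_ind (f := f')) => y v.
rewrite /f' /f /contr /= tmap_pure /= (grpP y).1 tassoc_pure !contractl_pure /= dE.
case: eqP => [->|_]; first by rewrite !scale1r subrr mem0v.
by rewrite !scale0r linear0 subr0 mem0v.
Qed.

End Coinvariants.

(** * The rank one condition *)

Section RankOne.
Variables (k : fieldType) (H : hopfType k).
Implicit Types (g h u v m w z : H) (x y : grp H).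
Notation H0 := (coradical H).

Hypothesis rank1 : has_rank H 1.
Let pt : pointed H := rank1.1.

Let bal := balance H0 (coradical1 H)
  (fun (c : k^o) (h : H) => counit h *: c) (fun h m => h * m).
Let tens : {vspace tensor k^o H} := tens_vspace {:k^o} (coradical1 H).

(** The isomorphism of [k (x) H] with [H]; it maps [bal] to [H0^+ H1], on which
    both the counit and, modulo [H0], [twist] composed with [comul] vanish. *)
Let eval : tensor k^o H -> H := contractl idfun.
HB.instance Definition _ := GRing.Linear.copy eval
  (contractl (idfun : k^o -> k^o)).

Let eval_pure (c : k^o) h : eval (pure c h) = (c : k) *: h.
Proof. by rewrite /eval contractl_pure. Qed.

Let bal_tens : (bal <= tens)%VS.
Proof.
apply: spanset_sub => _ [c [h [m [hH0 mH1 ->]]]].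
by rewrite memvB // memt_pure ?memvf // (coradical1M pt).
Qed.

Let eval_bal (c : k^o) h m :
  eval ((pure (counit h *: c : k^o) (m : H) : tensor k^o H) - pure c (h * m)) =
  (c : k) *: ((counit h : k) *: m - h * m).
Proof. by rewrite linearB /= !eval_pure scalerBr scalerA mulrC. Qed.

Let bal_twist : {in bal, forall t, twist (comul (eval t)) \in H0}.
Proof.
apply: (spanset_ind (f := twist (H := H) \o (comul \o eval))) => _ [c [h [m [hH0 mH1 ->]]]].
rewrite /= eval_bal [comul _]linearZ /= [twist _]linearZ /= memvZ //.
rewrite [comul _]linearB /= [comul (_ *: _)]linearZ /= [twist _]linearB /=.
rewrite [twist (_ *: _)]linearZ /=.
exact: twist_translate.
Qed.

Let bal_counit : {in bal, forall t, counit (eval t) = 0}.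
Proof.
move=> t tB; apply/eqP; rewrite -memv0; move: t tB.
apply: (spanset_ind (f := @counit k H \o eval)) => _ [c [h [m [hH0 mH1 ->]]]].
rewrite /= eval_bal !linearZ linearB linearZ /= counitM.
by rewrite -[counit h *: _]/(counit h * counit m) subrr scaler0 mem0v.
Qed.

(** [H1 / (H0^+ H1)] has dimension 2.  The counit and the projection on
    coinvariants are defined on it, and separate the classes of [1], [z] and
    [w] unless [w] is a multiple of [z] modulo [H0]. *)
Lemma rank1_homogeneous z w : homogeneous 1 z -> homogeneous 1 w -> z \notin H0 ->
  exists beta : k, w - beta *: z \in H0.
Proof.
move=> hz hw zH0; apply: contrapT => nw.
pose p (h : H) : tensor k^o H := pure (1 : k^o) h.
have evalp h : eval (p h) = h by rewrite eval_pure scale1r.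
have ptens x h : homogeneous (val x) h -> p h \in tens.
  by move=> hh; rewrite memt_pure ?memvf // (homogeneous_coradical1 hh).
have hom1 : homogeneous 1 (1 : H).
  by rewrite /homogeneous comul1 pure1 subrr mem0v.
have p1 : p 1 \notin bal.
  apply/negP => /bal_counit; rewrite evalp counit1 => /eqP.
  by rewrite oner_eq0.
have twist1 : twist (comul 1) \in H0.
  rewrite -[twist _](subrK 1); apply: memvD (coradical_1 H).
  exact: twist_homogeneous1.
have pz : p z \notin (<[p 1%R]> + bal)%VS.
  apply: contra zH0 => /memv_addP[_ /vlineP[c1 ->] [b bB E]].
  have := congr1 (fun t => twist (comul (eval t))) E.
  rewrite evalp !linearD !linearZ /= evalp => Ez.
  rewrite -[z](subKr (twist (comul z))) memvB //; last exact: twist_homogeneous1.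
  by rewrite Ez memvD ?memvZ // bal_twist.
have pw : p w \notin (<[p z]> + (<[p 1%R]> + bal))%VS.
  apply/negP => /memv_addP[_ /vlineP[c2 ->] [_ /memv_addP[_ /vlineP[c1 ->] [b bB ->]] E]].
  have := congr1 (fun t => twist (comul (eval t))) E.
  rewrite evalp !linearD !linearZ /= !evalp => Ew; apply: nw; exists c2.
  have tz := twist_homogeneous1 pt hz; have tw := twist_homogeneous1 pt hw.
  suff -> : w - c2 *: z = c2 *: (twist (comul z) - z)
      + (c1 *: twist (comul 1) + twist (comul (eval b))) - (twist (comul w) - w).
    by rewrite memvB // memvD ?memvZ // memvD ?memvZ // bal_twist.
  rewrite Ew opprB scalerBr [_ *: _ - _ + _]addrAC [RHS]addrC addrA.
  by rewrite subrK.
have tens3 : (<[p w]> + (<[p z]> + (<[p 1%R]> + bal)) <= tens)%VS.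
  rewrite !subv_add bal_tens -!memvE andbT.
  by rewrite (ptens 1%g w hw) (ptens 1%g z hz) (ptens 1%g 1 hom1).
have := dimvS tens3; rewrite !dimv_line_add //.
case: rank1 => _; rewrite /dim_tensor_over -/bal -/tens => dim2.
by rewrite -addn3 -leq_subRL ?dimvS // dim2.
Qed.

(** Translating the component of degree [x] by [x^-1] makes it a coinvariant. *)
Lemma rank1_coradical1 z : homogeneous 1 z -> z \notin H0 ->
  (coradical1 H <= H0 + H0 * <[z]>)%VS.
Proof.
move=> hz zH0; apply/subvP => m /(coradical1_homogeneous pt)[w [hw mw]].
rewrite -[m](subrK (\sum_x w x)) memvD //; first exact: (subvP (addvSl _ _)).
apply: memv_suml => x _.
have h1 : homogeneous 1 (val x^-1%g * w x).
  by have := homogeneous_mul pt x^-1%g (hw x); rewrite mulVg.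
have [beta bH0] := rank1_homogeneous hz h1 zH0.
have -> : w x = val x * (val x^-1%g * w x - beta *: z) + (beta *: val x) * z.
  rewrite mulrBr mulrA -val_grpM mulgV mul1r.
  by rewrite -scalerAl -scalerAr subrK.
by rewrite memv_add ?memv_mul ?memvZ ?memv_line ?(coradicalM pt) ?grp_coradical.
Qed.

End RankOne.

(** * Gaussian binomial coefficients *)

Section GaussianBinomials.
Variables (k : fieldType) (q : k).

Definition qnum n : k := \sum_(i < n) q ^+ i.

Fixpoint qbin n m : k :=
  match n, m with
  | _, 0 => 1
  | 0, _.+1 => 0
  | n'.+1, m'.+1 => qbin n' m' + q ^+ m'.+1 * qbin n' m'.+1
  end.

Arguments qbin : simpl never.

Lemma qbin0 n : qbin n 0 = 1. Proof. by case: n. Qed.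

Lemma qbinS n m : qbin n.+1 m.+1 = qbin n m + q ^+ m.+1 * qbin n m.+1.
Proof. by []. Qed.

Lemma qbin_small n m : (n < m)%N -> qbin n m = 0.
Proof.
elim: n m => [|n IH] [|m] // nm.
by rewrite qbinS !IH ?mulr0 ?addr0 // ltnS ltnW.
Qed.

Lemma qbinn n : qbin n n = 1.
Proof. by elim: n => [|n IH] //; rewrite qbinS IH qbin_small ?mulr0 ?addr0. Qed.

Lemma qnumS n : qnum n.+1 = 1 + q * qnum n.
Proof.
rewrite /qnum big_ord_recl expr0; congr (_ + _); rewrite mulr_sumr.
by apply: eq_bigr => i _; rewrite -exprS.
Qed.

(** At a zero of [qnum], this forces the inner coefficients of a row to
    vanish. *)
Lemma qbin_absorb n m : qnum m.+1 * qbin n.+1 m.+1 = qnum n.+1 * qbin n m.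
Proof.
elim: n m => [|n IH] m.
  case: m => [|m]; first by rewrite qbinS [qbin 0 1]qbin_small // mulr0 addr0.
  by rewrite [qbin 1 _]qbin_small // [qbin 0 _]qbin_small // !mulr0.
rewrite qbinS mulrDr mulrCA IH; case: m => [|m].
  by rewrite !qbin0 [qnum 1]qnumS [qnum n.+2]qnumS /qnum big_ord0; ring.
rewrite [qnum m.+2]qnumS mulrDl -mulrA IH.
by rewrite [qnum n.+2]qnumS [qbin n.+1 m.+1]qbinS [q ^+ m.+2]exprS; ring.
Qed.

Lemma qbin1 n : qbin n 1 = qnum n.
Proof.
case: n => [|n]; first by rewrite /qnum big_ord0.
by have := qbin_absorb n 0; rewrite qbin0 mulr1 [qnum 1]qnumS /qnum big_ord0 mulr0 addr0 mul1r.
Qed.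

(** The quantum characteristic of [q]: its order if [q != 1], the
    characteristic of the field if [q = 1]. *)
Definition qchar n :=
  [/\ (1 < n)%N, qnum n = 0 & forall j, (0 < j < n)%N -> qnum j != 0].

Lemma qbin_eq0 n j : qchar n -> (0 < j < n)%N -> qbin n j = 0.
Proof.
case: n j => [|n] [|j] // [_ qn qj] jn; apply/eqP; have := qbin_absorb n j.
by rewrite qn mul0r => /eqP; rewrite mulf_eq0 (negPf (qj _ jn)).
Qed.

End GaussianBinomials.

Arguments qbin {k} q n m : simpl never.

(** * Powers of a skew-primitive element *)

Section SkewPrimitivePowers.
Variables (k : fieldType) (H : hopfType k) (q : k) (a z : H).
Hypotheses (Dz : skew_primitive a 1 z) (za : z * a = q *: (a * z)).

Lemma comulX (h : H) i : comul (h ^+ i) = comul h ^+ i.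
Proof. by elim: i => [|i IH]; rewrite ?expr0 ?comul1 // !exprS comulM IH. Qed.

Lemma skew_commX j : z * a ^+ j = q ^+ j *: (a ^+ j * z).
Proof.
elim: j => [|j IH]; first by rewrite !expr0 mulr1 mul1r scale1r.
rewrite [a ^+ _]exprSr mulrA IH -scalerAl -[_ * z * a]mulrA za.
by rewrite -scalerAr scalerA mulrA -[q ^+ _ * q]exprSr.
Qed.

(** The q-binomial formula holds for [(A + B)^i] because [A = z (x) a] and
    [B = 1 (x) z] satisfy [B A = q A B]. *)
Lemma comul_skewX i : comul (z ^+ i) =
  \sum_(j < i.+1) qbin q i j *: pure (z ^+ j) (a ^+ j * z ^+ (i - j)).
Proof.
elim: i => [|i IH].
  by rewrite big_ord1 expr0 comul1 qbin0 scale1r mulr1 pure1.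
pose T j : tensor H H := pure (z ^+ j) (a ^+ j * z ^+ (i.+1 - j)).
rewrite exprS comulM IH Dz mulr_sumr.
transitivity (\sum_(j < i.+1) (qbin q i j *: T j.+1 + (q ^+ j * qbin q i j) *: T j)).
  apply: eq_bigr => j _; rewrite -tscalerAr mulrDl scalerDr !pureM; congr (_ + _).
    by rewrite /T -exprS mulrA -exprS subSS.
  rewrite /T mul1r mulrA skew_commX -scalerAl pureZr scalerA mulrC -mulrA -exprS.
  by rewrite subSn // -ltnS.
rewrite big_split /= [X in _ + X]big_ord_recl /= expr0 mul1r.
rewrite [RHS]big_ord_recl /= addrCA; congr (_ + _).
  by rewrite qbin0.
rewrite [in RHS]big_ord_recr big_ord_recr /= addrAC -big_split /=; congr (_ + _).
  by apply: eq_bigr => j _; rewrite -scalerDl.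
by rewrite qbinS [qbin q i i.+1]qbin_small ?mulr0 ?addr0.
Qed.

(** The middle terms of the q-binomial formula vanish at the quantum
    characteristic, as those of the binomial formula do at the characteristic. *)
Lemma skew_primitiveX n : qchar q n -> skew_primitive (a ^+ n) 1 (z ^+ n).
Proof.
move=> qn; have [n1 _ _] := qn; rewrite /skew_primitive comul_skewX.
case: n n1 qn => // n _ qn; rewrite big_ord_recr big_ord_recl /=.
rewrite big1 => [|j _]; last first.
  by rewrite qbin_eq0 ?scale0r //= ltnS ltn_ord.
by rewrite qbin0 qbinn subnn subn0 !expr0 !scale1r addr0 mul1r mulr1 addrC.
Qed.

Hypotheses (gl_a : grouplike a) (zH0 : z \notin coradical H).

Definition monomial (gi : grp H * nat) : H := val gi.1 * z ^+ gi.2.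

Definition monomials m : seq H := [seq monomial (gi.1, gi.2 : nat) | gi : grp H * 'I_m].

Let A : grp H := grp_of gl_a.

Lemma contract_monomial (f : {linear H -> k^o}) g i :
  contractl f (comul (monomial (g, i))) =
  \sum_(j < i.+1) (qbin q i j * (f (monomial (g, j : nat)) : k)) *:
    monomial ((g * A ^+ j)%g, i - j)%N.
Proof.
rewrite /monomial comulM (grpP g).1 comul_skewX mulr_sumr linear_sum.
apply: eq_bigr => j _; rewrite -tscalerAr pureM linearZ /= contractl_pure scalerA.
by rewrite val_grpX mulrA.
Qed.

Lemma monomials_mem m g i : (i < m)%N -> monomial (g, i) \in <<monomials m>>%VS.
Proof.
move=> im; pose f (gi : grp H * 'I_m) := monomial (gi.1, gi.2 : nat).
exact: (mem_span_image f (g, Ordinal im)).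
Qed.

Lemma monomials_ind m (W : vectType k) (f : {linear H -> W}) (U : {vspace W}) :
  (forall g i, (i < m)%N -> f (monomial (g, i)) \in U) ->
  {in <<monomials m>>%VS, forall v, f v \in U}.
Proof.
move=> fU v /span_imageP[c ->]; rewrite linear_sum memv_suml // => gi _.
by rewrite linearZ memvZ // fU.
Qed.

Lemma monomials0 : <<monomials 0>>%VS = 0%VS.
Proof.
apply/eqP; rewrite -subv0; apply/subvP => v.
by apply: (monomials_ind (f := idfun)) => g [].
Qed.

Lemma monomials1 : <<monomials 1>>%VS = <<[seq val x | x : grp H]>>%VS.
Proof.
apply/eqP; rewrite eqEsubv; apply/andP; split.
  apply/subvP; apply: (monomials_ind (f := idfun)) => g [] //= _.
  by rewrite /monomial mulr1 (mem_span_image (fun x : grp H => val x) g).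
apply/span_subvP => _ /imageP[g _ ->]; have := @monomials_mem 1 g 0 isT.
by rewrite /monomial mulr1.
Qed.

Definition independent_at m := forall c : grp H -> k,
  \sum_g c g *: monomial (g, m) \in <<monomials m>>%VS -> forall g, c g = 0.

Lemma free_monomials m : (forall i, (i < m)%N -> independent_at i) -> free (monomials m).
Proof.
elim: m => [|m IH] ind.
  have -> : monomials 0 = [::]; last exact: nil_free.
  by apply: size0nil; rewrite size_image card_prod card_ord muln0.
have {IH}fr : free (monomials m) by apply: IH => i im; apply: ind; rewrite ltnW.
have [d dE] := free_dual fr.
apply: free_imageP => c c0.
pose lo : H := \sum_(gi : grp H * 'I_m)
  c (gi.1, widen_ord (leqnSn m) gi.2) *: monomial (gi.1, gi.2 : nat).
have E : lo + \sum_g c (g, ord_max) *: monomial (g, m) = 0.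
  rewrite -[RHS]c0 [RHS](_ : _ = \sum_g \sum_(i < m.+1) c (g, i) *: monomial (g, i : nat)).
    rewrite exchange_big big_ord_recr /=; congr (_ + _).
    by rewrite exchange_big pair_bigA.
  by rewrite pair_bigA; apply: eq_bigr => -[].
have top g : c (g, ord_max) = 0.
  apply: (ind m (ltnSn m) (fun g => c (g, ord_max))).
  move/eqP: E; rewrite addrC addr_eq0 => /eqP ->; rewrite memvN.
  by apply: memv_suml => gi _; rewrite memvZ // monomials_mem.
have lo0 : lo = 0.
  rewrite -[RHS]E -[LHS]addr0; congr (_ + _); rewrite big1 // => g _.
  by rewrite top scale0r.
move=> [g i]; case: (unliftP ord_max i) => [j ->|->]; last exact: top.
have := congr1 (d (g, j)) lo0; rewrite linear0 linear_sum (bigD1 (g, j)) //=.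
rewrite big1 => [|[h l] /negPf ne].
  rewrite linearZ /= (dE (g, j) (g, j)) eqxx addr0 => /eqP.
  rewrite scaler_eq0 oner_eq0 orbF => /eqP <-.
  by congr (c (_, _)); apply: val_inj; rewrite /= /bump leqNgt ltn_ord.
by rewrite linearZ /= (dE (g, j) (h, l)) eq_sym ne scaler0.
Qed.

Variable n : nat.
Hypotheses (qn : qchar q n) (pt : pointed H).

(** Contracting the left leg of [comul (h z^m)] by the coordinate form of [g z]
    behaves as a q-derivative: for [h = g] it gives [[m]_q g a z^(m-1)] up to
    lower degree, which reduces degree [m] to degree [m - 1].  The contraction
    needs [g z] to be among the independent monomials of degree less than [m], so
    [m = 1] is treated apart, by the coordinate form of [g]. *)
Lemma independent_monomials m : (m < n)%N -> independent_at m.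
Proof.
elim/ltn_ind: m => m IH mn.
have fr : free (monomials m).
  by apply: free_monomials => i im; apply: IH => //; apply: ltn_trans mn.
case: m IH mn fr => [|[|m]] IH mn fr c.
- rewrite monomials0 memv0 => /eqP c0 g.
  have [d dE] := free_dual (free_grp H).
  have := congr1 (d g) c0; rewrite linear0 linear_sum (bigD1 g) //= big1 => [|h /negPf ne].
    rewrite linearZ /= /monomial mulr1 dE eqxx addr0 => /eqP.
    by rewrite scaler_eq0 oner_eq0 orbF => /eqP.
  by rewrite linearZ /= /monomial mulr1 dE eq_sym ne scaler0.
- (* contracting the relation leaves [c g (g z)] modulo [H0] *)
  rewrite monomials1 -(coradical_span pt) => cH0 g.
  have [d dE] := free_dual (free_grp H).
  have : contractl (V := H) (d g) (comul (\sum_g c g *: monomial (g, 1%N))) \in coradical H.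
    move: (coradical_comul pt cH0).
    apply: (tens_vspace_ind (f := contractl (V := H) (d g))) => u v _ vH.
    by rewrite /= contractl_pure memvZ.
  rewrite !linear_sum /= => sumH0.
  have : \sum_h (c h * (g == h)%:R) *: monomial (h, 1%N) \in coradical H.
    rewrite -[X in X \in _](subrK
      (\sum_h contractl (V := H) (d g) (comul (c h *: monomial (h, 1%N))))).
    apply: memvD sumH0; rewrite -sumrB; apply: memv_suml => h _.
    have -> : contractl (V := H) (d g) (comul (c h *: monomial (h, 1%N))) =
        c h *: contractl (V := H) (d g) (comul (monomial (h, 1%N))) by rewrite !linearZ.
    rewrite contract_monomial big_ord_recl big_ord1 /= qbin0 mul1r.
    have -> : d g (monomial (h, 0%N)) = (g == h)%:R by rewrite /monomial mulr1 dE.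
    rewrite expg0 mulg1 subn0 scalerDr scalerA opprD addrA subrr add0r.
    by rewrite memvN !memvZ // /monomial mulr1 grp_coradical.
  rewrite (bigD1 g) //= eqxx mulr1 big1 => [|h /negPf ne]; last first.
    by rewrite eq_sym ne mulr0 scale0r.
  rewrite addr0 => cgH0; apply/eqP; apply: contraNT zH0 => cg0.
  have -> : z = val g^-1%g * ((c g)^-1 *: (c g *: monomial (g, 1%N))).
    by rewrite scalerA mulVf // scale1r /monomial mulrA -val_grpM mulVg mul1r.
  by rewrite coradicalM ?grp_coradical // memvZ.
- (* [low] and [top] compute the contraction of the relation in two ways *)
  move=> cV g; have [d dE] := free_dual fr.
  pose i1 : 'I_m.+2 := Ordinal (isT : 1 < m.+2)%N.
  have dE' h j : (j < m.+2)%N -> d (g, i1) (monomial (h, j)) = ((g == h) && (1%N == j))%:R.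
    by move=> jm; rewrite (dE (g, i1) (h, Ordinal jm)).
  have low : contractl (V := H) (d (g, i1)) (comul (\sum_g c g *: monomial (g, m.+2)))
      \in <<monomials m.+1>>%VS.
    move: cV; apply: (monomials_ind (f := contractl (V := H) (d (g, i1)) \o comul)) => h i im.
    rewrite /= contract_monomial; apply: memv_suml => -[[|j] ji] _.
      by rewrite dE' // andbF mulr0 scale0r mem0v.
    apply/memvZ/monomials_mem => /=; rewrite ltnS in im.
    by case: i im ji => [|i] // im ji; rewrite subSS; apply: leq_ltn_trans (leq_subr _ _) im.
  have lin : contractl (V := H) (d (g, i1)) (comul (\sum_g c g *: monomial (g, m.+2))) =
      \sum_h c h *: contractl (V := H) (d (g, i1)) (comul (monomial (h, m.+2))).
    by rewrite !linear_sum; apply: eq_bigr => h _; rewrite !linearZ.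
  pose i1' : 'I_m.+3 := Ordinal (isT : 1 < m.+3)%N.
  have top h : contractl (V := H) (d (g, i1)) (comul (monomial (h, m.+2))) -
      ((g == h)%:R * qnum q m.+2) *: monomial ((g * A)%g, m.+1) \in <<monomials m.+1>>%VS.
    rewrite contract_monomial (bigD1 i1') //= qbin1 dE' // andbT addrAC.
    rewrite memvD //.
      case: eqP => [->|_]; last by rewrite mulr0 mul0r !scale0r subrr mem0v.
      by rewrite mulr1 mul1r expg1 subSS subn0 subrr mem0v.
    apply: memv_suml => -[j jm] jne; move: (jm); rewrite /= ltnS leq_eqVlt.
    (* the form is unknown on [h z^(m+2)], but the right leg is then in [H0] *)
    case/orP => [/eqP ->|jm2]; first by rewrite subnn memvZ // monomials_mem.
    rewrite dE' // [1%N == j]eq_sym.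
    have /negPf -> : j != 1%N by apply: contraNneq jne => j1; apply/eqP/val_inj.
    by rewrite andbF mulr0 scale0r mem0v.
  have : (c g * qnum q m.+2) *: monomial ((g * A)%g, m.+1) \in <<monomials m.+1>>%VS.
    have -> : (c g * qnum q m.+2) *: monomial ((g * A)%g, m.+1) =
        contractl (V := H) (d (g, i1)) (comul (\sum_g c g *: monomial (g, m.+2))) -
        \sum_h c h *: (contractl (V := H) (d (g, i1)) (comul (monomial (h, m.+2))) -
          ((g == h)%:R * qnum q m.+2) *: monomial ((g * A)%g, m.+1)).
      rewrite lin -sumrB (bigD1 g) //= big1 => [|h /negPf ne].
        by rewrite addr0 scalerBr opprB addrC subrK eqxx mul1r scalerA.
      by rewrite [g == h]eq_sym ne mul0r scale0r subr0 subrr.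
    by rewrite memvB // memv_suml // => h _; rewrite memvZ.
  have -> : (c g * qnum q m.+2) *: monomial ((g * A)%g, m.+1) =
      \sum_h ((h == g * A)%g%:R * (c g * qnum q m.+2)) *: monomial (h, m.+1).
    rewrite (bigD1 (g * A)%g) //= big1 => [|h /negPf ne]; last by rewrite ne mul0r scale0r.
    by rewrite eqxx mul1r addr0.
  move=> /(IH m.+1 (ltnSn _) (ltnW mn)) /(_ (g * A)%g) /eqP.
  have [_ _ qnz] := qn.
  by rewrite eqxx mul1r mulf_eq0 (negPf (qnz _ _)) ?orbF ?mn // => /eqP.
Qed.

Lemma free_monomials_qchar : free (monomials n).
Proof. by apply: free_monomials => i; apply: independent_monomials. Qed.

End SkewPrimitivePowers.

(** * The antipode on products *)

Section Antipode.
Variables (k : fieldType) (H : hopfType k).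
Implicit Types (u v w : H) (g : grp H).

Lemma tmul_linear_r (s : tensor H H) : linear (fun t : tensor H H => t * s).
Proof. exact: tmul_linl. Qed.

(** [id * S] sends [u g] to [eps(u)], which is [u_1 g S(u_2 g)]; so
    [u |-> g S(u g)] is, like [S], a convolution inverse of the identity. *)
Lemma antipode_mulr_grp u g : antipode (u * val g) = (val g)^-1 * antipode u.
Proof.
have [F FE] : exists F : 'End(H), forall v,
    F v = antipode v - val g * antipode (v * val g).
  exists (antipode - (amull (val g) \o antipode \o amulr (val g))%VF) => v.
  by rewrite add_lfunE opp_lfunE !comp_lfunE !lfunE.
have convF t : conv idfun F t =
    conv idfun (@antipode k H) t - conv idfun (@antipode k H) (t * pure (val g) (val g)).
  elim/tensor_ind: t => [c s t IHs IHt||v w].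
  - rewrite (tmul_linear_r _ c) /conv !tlift_linear -/(conv _ _) IHs IHt.
    by rewrite scalerBr opprD addrACA.
  - by rewrite mul0r !linear0 addr0.
  - by rewrite pureM !conv_pure /= FE mulrBr mulrA.
have F0 v : F v = 0.
  apply: conv_id_inj => {}v; rewrite convF -[pure _ _](grpP g).1 -comulM.
  by rewrite !conv_antipoder counitM (grpP g).2 mulr1 subrr.
have := F0 u; rewrite FE => /eqP; rewrite subr_eq0 => /eqP ->.
by rewrite mulKr // grp_unit.
Qed.

(** [0 = eps(u w) = u_1 w S(u_2 g) + u_1 S(u_2 w)] is the convolution of the
    identity with the difference of the two sides. *)
Lemma antipode_mulr_skew u g w : skew_primitive (val g) 1 w -> counit w = 0 ->
  antipode (u * w) = - (w * (val g)^-1) * antipode u.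
Proof.
move=> Dw ew.
have [F FE] : exists F : 'End(H), forall v,
    F v = w * (val g)^-1 * antipode v + antipode (v * w).
  exists ((amull (w * (val g)^-1) \o antipode)%VF + (antipode \o amulr w)%VF) => v.
  by rewrite add_lfunE !comp_lfunE !lfunE.
have convF t : conv idfun F t = conv idfun (@antipode k H) (t * comul w).
  rewrite Dw mulrDr; elim/tensor_ind: t => [c s t IHs IHt||v v'].
  - rewrite !(tmul_linear_r _ c) addrACA -scalerDr /conv !tlift_linear -/(conv _ _).
    by rewrite IHs IHt.
  - by rewrite !mul0r addr0 !linear0.
  - rewrite !pureM linearD /= !conv_pure mulr1 /= -[ssval g]/(val g) antipode_mulr_grp.
    by rewrite FE mulrDr !mulrA.
have := @conv_id_inj _ _ F _ u; rewrite /= FE addrC => F0; apply/eqP.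
rewrite mulNr -addr_eq0; apply/eqP/F0 => v.
by rewrite convF -comulM conv_antipoder counitM ew mulr0 scale0r.
Qed.

End Antipode.

(** * Skew-primitive elements *)

Section SkewPrimitives.
Variables (k : fieldType) (H : hopfType k).
Implicit Types (u v w y z : H) (b g : grp H).
Notation H0 := (coradical H).

Lemma skew_primitive_counit b w : skew_primitive (val b) 1 w -> counit w = 0.
Proof.
move=> Dw; have := contractl_counit w; rewrite Dw linearD /= !contractl_pure /=.
rewrite counit1 scale1r => /eqP; rewrite -subr_eq0 addrK scaler_eq0.
by rewrite (negPf (grouplike_neq0 (grpP b))) orbF => /eqP.
Qed.

(** The projection along [H0] on the left leg kills [leftH0]. *)
Lemma pure_leftH0 u v : pure u v \in leftH0 H -> v != 0 -> u \in H0.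
Proof.
move=> uv v0.
pose f : {linear tensor H H -> tensor H H} := tmap (idfun \- projv H0) idfun.
have : f (pure u v) \in 0%VS.
  move: uv; apply: (tens_vspace_ind (f := f)) => u' v' uH _.
  rewrite /f /= tmap_pure /= projv_id // subrr.
  by rewrite -(scale0r (0 : H)) pureZl scale0r mem0v.
rewrite memv0 /f /= tmap_pure /= => /eqP/pure_eq0[/eqP|/eqP]; last by rewrite (negPf v0).
by rewrite subr_eq0 => /eqP ->; apply: memv_proj.
Qed.

Hypothesis pt : pointed H.

(** Contracting [comul y = y (x) b + 1 (x) y] by the coordinate form of the
    group-like [1] gives [y_1 1 = y_1 b + y]. *)
Lemma coradical_skew_primitive b y : y \in H0 -> skew_primitive (val b) 1 y ->
  exists c : k, y = c *: (val b - 1).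
Proof.
move=> yH0 Dy; have [d dE] := free_dual (free_grp H).
have ctr : contractl (V := H) (d 1%g) (comul y) = (d 1%g y : k) *: 1.
  elim/(coradical_ind pt): y / yH0 {Dy} => [c u v uE vE||g].
  - rewrite [comul _]linearP /= [contractl _ _]linearP /= uE vE linearP /=.
    by rewrite scalerDl scalerA.
  - by rewrite !linear0 scale0r.
  - rewrite (grpP g).1 contractl_pure dE; case: eqP => [<-|_]; first by rewrite val_grp1.
    by rewrite !scale0r.
have := ctr; rewrite Dy linearD /= !contractl_pure -{1}(val_grp1 H) dE eqxx scale1r => E.
exists (- d 1%g y); rewrite scaleNr -scalerN opprB scalerBr -E.
by rewrite addrC addrA addNr add0r.
Qed.

Hypothesis rank1 : has_rank H 1.
Variables (a : grp H) (z : H).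
Hypotheses (Dz : skew_primitive (val a) 1 z) (zH0 : z \notin H0).

Lemma skew_primitive_homogeneous b w : skew_primitive (val b) 1 w -> homogeneous 1 w.
Proof.
by move=> Dw; rewrite /homogeneous Dw addrK memt_pure ?memvf ?grp_coradical.
Qed.

(** Write [w = y + beta z] with [y] in [H0].  Comparing coproducts, modulo
    [H0 (x) H] all that remains is [beta z (x) (b - a)], so [beta = 0] or
    [b = a]; in both cases [y] is itself in [P_{b,1}]. *)
Lemma skew_primitiveP b w : skew_primitive (val b) 1 w ->
  exists beta c : k, w = beta *: z + c *: (val b - 1) /\ (beta = 0 \/ b = a).
Proof.
move=> Dw.
have [beta wzH0] := rank1_homogeneous rank1 (skew_primitive_homogeneous Dz)
  (skew_primitive_homogeneous Dw) zH0.
have [y wE yH0] : exists2 y, w = y + beta *: z & y \in H0.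
  by exists (w - beta *: z); rewrite ?subrK.
exists beta.
have Dy : comul y = pure y (val b) + pure 1 y + pure (beta *: z) (val b - val a).
  apply: (addIr (beta *: comul z)); transitivity (comul w).
    by rewrite [in RHS]wE linearD linearZ.
  rewrite Dw {1 2}wE pure_addl !pure_addr pureNr !pureZl pureZr Dz scalerDr.
  by rewrite [LHS]addrACA -[RHS]addrA; congr (_ + _); rewrite addrA subrK.
have ab : beta = 0 \/ b = a.
  case: (eqVneq b a) => [|ba]; [by right|left].
  apply/eqP; apply: contraNT zH0 => beta0.
  suff bzH0 : beta *: z \in H0.
    by rewrite -[z]scale1r -(mulVf beta0) -scalerA; apply: memvZ.
  have ba0 : val b - val a != 0.
    by rewrite subr_eq0; apply: contraNneq ba => /val_inj ->.
  apply: (pure_leftH0 _ ba0).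
  have -> : pure (beta *: z) (val b - val a) = comul y - (pure y (val b) + pure 1 y).
    by rewrite Dy [RHS]addrC addKr.
  rewrite memvB ?memvD ?memt_pure ?memvf ?coradical_1 //.
  by apply: (subvP (tens_vspaceS (subvv _) (subvf _))); apply: (coradical_comul pt).
have [c yc] : exists c : k, y = c *: (val b - 1).
  apply: coradical_skew_primitive => //; rewrite /skew_primitive Dy.
  case: ab => ->; first by rewrite scale0r -(scale0r 0) pureZl scale0r addr0.
  by rewrite subrr -(scale0r 0) pureZr scale0r addr0.
by exists c; rewrite -yc addrC.
Qed.

End SkewPrimitives.

(** * Generators and relations *)

Section Structure.
Variables (k : fieldType) (H : hopfType k).
Implicit Types (u v w y : H) (g h : grp H).
Notation H0 := (coradical H).

Hypothesis rank1 : has_rank H 1.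
Let pt : pointed H := rank1.1.
Variables (a : grp H) (x : H).
Hypotheses (Dx : skew_primitive (val a) 1 x) (xH0 : x \notin H0).

Lemma skew_coords_inj (s s' c c' : k) :
  s *: x + c *: (val a - 1) = s' *: x + c' *: (val a - 1) ->
  s = s' /\ (a != 1%g -> c = c').
Proof.
move=> E; have aH0 : val a - 1 \in H0 by rewrite grpB1_coradical.
have E2 : (s - s') *: x = (c' - c) *: (val a - 1).
  by apply/eqP; rewrite !scalerBl subr_eq addrAC eq_sym subr_eq addrC -E addrC.
have ss : s = s'.
  apply/eqP; rewrite -subr_eq0; apply: contraNT xH0 => s0.
  by rewrite -[x]scale1r -(mulVf s0) -scalerA E2; do 2!apply: memvZ.
split=> // a1; move/eqP: E2; rewrite ss subrr scale0r eq_sym scaler_eq0.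
have /negPf -> : val a - 1 != 0.
  by rewrite subr_eq0; apply: contraNneq a1 => E1; apply/eqP/val_inj.
by rewrite orbF subr_eq0 => /eqP.
Qed.

(** The scalar [c] is not determined by the equation when [a = 1]; it is then
    set to [0], which keeps the cocycle identity valid. *)
Lemma conj_skew_primitive g : exists s c : k,
  [/\ val g * x * val g^-1%g = s *: x + c *: (val a - 1), s != 0,
      (g * a)%g = (a * g)%g & a = 1%g -> c = 0].
Proof.
have Dgx : skew_primitive (val (g * a * g^-1)%g) 1 (val g * x * val g^-1%g).
  rewrite /skew_primitive !comulM Dx (grpP g).1 (grpP g^-1%g).1 mulrDr mulrDl !pureM.
  by rewrite mulr1 -!val_grpM mulgV val_grp1.
have [s [c [E sa]]] := skew_primitiveP pt rank1 Dx xH0 Dgx.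
have s0 : s != 0.
  apply: contraNneq xH0 => s0.
  have -> : x = val g^-1%g * (val g * x * val g^-1%g) * val g.
    by rewrite !mulrA -val_grpM mulVg mul1r -mulrA -val_grpM mulVg mulr1.
  rewrite E s0 scale0r add0r !coradicalM ?grp_coradical //.
  by rewrite memvZ // grpB1_coradical.
have ga : (g * a * g^-1)%g = a by case: sa => // /eqP; rewrite (negPf s0).
rewrite ga in E; exists s, (if a == 1%g then 0 else c); split=> // [||->]; last by rewrite eqxx.
  by rewrite E; case: eqP => // ->; rewrite val_grp1 subrr !scaler0.
by rewrite -[in RHS]ga mulgKV.
Qed.

(** The character and cocycle laws are read off by conjugating [x] by [g] and
    then by [h], coordinates in [x] and [a - 1] being unique. *)
Lemma conj_data_exists : exists (chi c : grp H -> k),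
  [/\ forall g, val g * x * val g^-1%g = chi g *: x + c g *: (val a - 1),
      linear_character chi,
      forall g h, c (h * g)%g = chi g * c h + c g,
      forall g, (g * a)%g = (a * g)%g & (forall g, chi g != 0) /\
      forall s, val a * x = s *: (x * val a) -> chi a = s /\ c a = 0].
Proof.
have /choice[sc scP] : forall g, exists sc : k * k,
    [/\ val g * x * val g^-1%g = sc.1 *: x + sc.2 *: (val a - 1), sc.1 != 0,
        (g * a)%g = (a * g)%g & a = 1%g -> sc.2 = 0].
  by move=> g; have [s [c ?]] := conj_skew_primitive g; exists (s, c).
exists (fun g => (sc g).1), (fun g => (sc g).2).
have conj1 : (sc 1%g).1 = 1.
  have [E _ _ _] := scP 1%g.
  have := @skew_coords_inj (sc 1%g).1 1 (sc 1%g).2 0; case=> //.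
  by rewrite -E scale1r scale0r addr0 invg1 val_grp1 mul1r mulr1.
have mulP h g : (sc (h * g)%g).1 = (sc h).1 * (sc g).1 /\
    (sc (h * g)%g).2 = (sc g).1 * (sc h).2 + (sc g).2.
  have [Eg _ ga a1g] := scP g; have [Eh _ ha a1h] := scP h.
  have [Ehg _ _ a1hg] := scP (h * g)%g.
  have [] := @skew_coords_inj (sc (h * g)%g).1 ((sc h).1 * (sc g).1)
    (sc (h * g)%g).2 ((sc g).1 * (sc h).2 + (sc g).2).
    rewrite -Ehg invMg !val_grpM.
    have -> : val h * val g * x * (val g^-1%g * val h^-1%g) =
      val h * (val g * x * val g^-1%g) * val h^-1%g by rewrite !mulrA.
    rewrite Eg mulrDr mulrDl -!scalerAr -!scalerAl Eh mulrBr mulrBl mulr1.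
    rewrite -!val_grpM ha mulgK mulgV val_grp1 scalerDr !scalerA scalerDl.
    by rewrite -addrA [(sc h).1 * _]mulrC.
  move=> -> E2; split=> //; case: (eqVneq a 1%g) => [a1|/E2 //].
  by rewrite (a1g a1) (a1h a1) (a1hg a1) mulr0 addr0.
split=> [g||g h|g|]; [by case: (scP g)| |by case: (mulP h g)|by case: (scP g)|].
  by split=> // g h; case: (mulP g h).
split=> [g|s as_]; first by case: (scP g).
have [E _ _ a1] := scP a.
have [] := @skew_coords_inj (sc a).1 s (sc a).2 0.
  rewrite -E as_ -scalerAl -mulrA -val_grpM mulgV mulr1.
  by rewrite scale0r addr0.
by move=> -> E2; split=> //; case: (eqVneq a 1%g).
Qed.

Lemma counit_skew : counit x = 0. Proof. exact: skew_primitive_counit Dx. Qed.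

Lemma antipode_monomial g i :
  antipode (val g * x ^+ i) = (- (x * val a^-1%g)) ^+ i * val g^-1%g.
Proof.
elim: i => [|i IH]; first by rewrite !expr0 mulr1 mul1r (antipode_grouplike (grpP g)).
rewrite exprSr mulrA (antipode_mulr_skew _ Dx counit_skew) IH exprS mulrA.
by rewrite val_grpV.
Qed.

Lemma skew_hopf_structure_grp n : skew_hopf_structure (fun g => val g) a x n.
Proof.
move=> g i _; split; last exact: antipode_monomial.
  by rewrite comulM comulX (grpP g).1 Dx.
have counitX j : counit (x ^+ j) = counit x ^+ j.
  by elim: j => [|j IH]; rewrite ?expr0 ?counit1 // !exprS counitM IH.
by rewrite counitM (grpP g).2 mul1r counitX counit_skew expr0n.
Qed.

Hypothesis gen : <<coradical1 H>>%AS = {:H}%AS.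

(** The span is stable under left multiplication by [H0], and by [x] since
    [x g = g (g^-1 x g)], hence by the subalgebra that [H1] generates. *)
Lemma monomials_span n (chi c : grp H -> k) : (1 < n)%N ->
  (forall g, val g * x * val g^-1%g = chi g *: x + c g *: (val a - 1)) ->
  x ^+ n \in (H0 + <[x]>)%VS -> <<monomials x n>>%VS = fullv.
Proof.
move=> n1 conj xn; set V := <<_>>%VS.
have n0 : (0 < n)%N := ltnW n1.
have mulV u : (forall g i, (i < n)%N -> u * monomial x (g, i) \in V) ->
    forall v, v \in V -> u * v \in V.
  move=> uV v vV; have -> : u * v = amull u v by rewrite lfunE.
  by apply: (monomials_ind (f := amull u)) vV => g i im; rewrite /= lfunE /= uV.
have grpV g : forall v, v \in V -> val g * v \in V.
  apply: mulV => h i im.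
  by rewrite /monomial mulrA -val_grpM (monomials_mem x (g * h)%g im).
have H0V u v : u \in H0 -> v \in V -> u * v \in V.
  move=> + vV; elim/(coradical_ind pt) => [e u1 u2 uV uV'||g].
  - by rewrite mulrDl -scalerAl memvD // memvZ.
  - by rewrite mul0r mem0v.
  - exact: grpV.
have xV i : (i < n)%N -> x ^+ i \in V.
  by move=> im; have := monomials_mem x 1%g im; rewrite /monomial /= mul1r.
have xnV : x ^+ n \in V.
  have [u uH0 [_ /vlineP[s ->] ->]] := memv_addP xn.
  rewrite memvD //; first by have := H0V _ _ uH0 (xV 0%N n0); rewrite mulr1.
  by rewrite memvZ // -[x]expr1 xV.
have xVV : forall v, v \in V -> x * v \in V.
  apply: mulV => g i im; rewrite /monomial /=.
  have -> : x * (val g * x ^+ i) =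
      val g * ((chi g^-1%g *: x + c g^-1%g *: (val a - 1)) * x ^+ i).
    rewrite -conj invgK !mulrA -[val g * val g^-1%g]val_grpM mulgV.
    by rewrite mul1r -!mulrA.
  rewrite mulrDl -!scalerAl -exprS mulrDr -!scalerAr memvD ?memvZ ?grpV //.
    by case: (ltngtP i.+1 n) im => // [im _|->]; [apply: xV|].
  by rewrite H0V ?xV // grpB1_coradical.
have sub1 : (coradical1 H * V <= V)%VS.
  apply/prodvP => u v uH1 vV.
  have /memv_addP[y yH0 [w wH0x ->]] := subvP (rank1_coradical1 rank1
    (skew_primitive_homogeneous Dx) xH0) u uH1.
  rewrite mulrDl memvD //; first exact: H0V.
  have /subvP/(_ w wH0x) : (H0 * <[x]> <= amulr v @^-1: V)%VS.
    apply/prodvP => y' _ hH0 /vlineP[s ->].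
    by rewrite -memv_preim lfunE /= -scalerAr -scalerAl memvZ // -mulrA H0V // xVV.
  by rewrite -memv_preim lfunE.
have oneV : (1 <= V)%VS by rewrite -memvE -(expr0 x) xV.
apply/eqP; rewrite eqEsubv subvf /=.
by have := agenv_sub_modl oneV sub1; rewrite -[agenv _]/(asval <<coradical1 H>>%AS) gen.
Qed.

Lemma monomial_basis_grp (q : k) n (chi c : grp H -> k) :
  qchar q n -> x * val a = q *: (val a * x) ->
  (forall g, val g * x * val g^-1%g = chi g *: x + c g *: (val a - 1)) ->
  x ^+ n \in (H0 + <[x]>)%VS -> monomial_basis (fun g : grp H => val g) x n.
Proof.
move=> qn xa conj xn; have [n1 _ _] := qn.
change (basis_of fullv (monomials x n)).
rewrite basisEfree (free_monomials_qchar Dx xa (grpP a) xH0 qn pt) subvf /=.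
by rewrite -(monomials_span n1 conj xn) dim_span.
Qed.

Lemma skew_primitive_power (q : k) n : qchar q n -> x * val a = q *: (val a * x) ->
  exists beta alpha : k,
    x ^+ n = beta *: x + alpha *: (val (a ^+ n)%g - 1) /\ (beta = 0 \/ (a ^+ n)%g = a).
Proof.
move=> qn xa; have := skew_primitiveX Dx xa qn.
by rewrite -val_grpX => /(skew_primitiveP pt rank1 Dx xH0).
Qed.

End Structure.

Lemma hopf_isomorphic_refl (k : fieldType) (H : hopfType k) : hopf_isomorphic H H.
Proof.
have tmap_id t : tmap (\1%AF : 'AHom(H, H)) (\1%AF : 'AHom(H, H)) t = t.
  rewrite /tmap [RHS]tensorE; apply: eq_tlift => u v.
  by rewrite !id_lfunE.
exists \1%AF; split=> [|h|h|h].
- by exists id => h; rewrite id_lfunE.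
- by rewrite tmap_id id_lfunE.
- by rewrite id_lfunE.
- by rewrite !id_lfunE.
Qed.

(** * Scalars *)

Section Scalars.
Variable k : fieldType.

Lemma closed_field_root (e : k) n : GRing.closed_field_axiom k -> (0 < n)%N ->
  exists x : k, x ^+ n = e.
Proof.
move=> closed n0; have [x xE] := closed n (fun i => if i == 0%N then e else 0) n0.
exists x; rewrite xE; case: n n0 {xE} => // n _.
by rewrite big_ord_recl /= expr0 mulr1 big1 ?addr0 // => i _; rewrite mul0r.
Qed.

(** Otherwise ['X^p - 'X] would have [p + 1] roots. *)
Lemma pchar_prime_subfield p (e : k) : p \in [pchar k] -> e ^+ p = e ->
  exists m : nat, e = m%:R.
Proof.
move=> cp ep; have pp := pcharf_prime cp; have p1 := prime_gt1 pp.
pose s : seq k := [seq i%:R | i <- iota 0 p].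
have us : uniq s.
  rewrite map_inj_in_uniq ?iota_uniq // => i j; rewrite !mem_iota /= !add0n.
  wlog ij : i j / (i <= j)%N => [wh ip jp E|ip jp E].
    by case/orP: (leq_total i j) => [/wh|/wh /(_ jp ip (esym E))] //; apply.
  have : (p %| j - i)%N by rewrite (dvdn_pcharf cp) natrB // E subrr.
  apply: contraTeq => ne; have ltij : (i < j)%N by rewrite ltn_neqAle ne.
  by rewrite gtnNdvd ?subn_gt0 // (leq_ltn_trans (leq_subr _ _) jp).
have pK i : (i%:R : k) ^+ p = i%:R.
  by rewrite -(pFrobenius_autE cp) pFrobenius_aut_nat.
have sP : size ('X^p - 'X : {poly k}) = p.+1.
  by rewrite size_polyDl size_polyXn ?size_polyN ?size_polyX.
have P0 : 'X^p - 'X != 0 :> {poly k} by rewrite -size_poly_eq0 sP.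
case: (boolP (e \in s)) => [/mapP[m _ ->]|es]; first by exists m.
have := max_poly_roots P0 (rs := e :: s); rewrite sP /= es us size_map size_iota ltnn.
suff -> : root ('X^p - 'X) e && all (root ('X^p - 'X)) s by move=> /(_ isT isT).
rewrite /root !hornerE ep subrr eqxx /=; apply/allP => _ /mapP[m _ ->].
by rewrite /root !hornerE pK subrr.
Qed.

Lemma qchar1 p : p \in [pchar k] -> qchar (1 : k) p.
Proof.
move=> cp; have qnumE j : qnum (1 : k) j = j%:R.
  rewrite /qnum (eq_bigr (fun=> 1)) => [|i _]; last by rewrite expr1n.
  by rewrite sumr_const card_ord.
split; [exact/prime_gt1/(pcharf_prime cp)|by rewrite qnumE pcharf0|].
by move=> j /andP[j0 jp]; rewrite qnumE -(dvdn_pcharf cp) gtnNdvd.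
Qed.

(** The inverse occurs because an eigenvalue [q] means
    [z a = q^-1 (a z)]. *)
Lemma qchar_primitive_rootV (q : k) n :
  n.-primitive_root q -> q != 1 -> qchar q^-1 n.
Proof.
move=> prq q1; have n0 := prim_order_gt0 prq.
have qnumE j : (qnum q^-1 j == 0) = (q ^+ j == 1).
  rewrite -[RHS]invr_eq1 -exprVn -[RHS]subr_eq0 subrX1 mulf_eq0 subr_eq0.
  by rewrite invr_eq1 (negPf q1).
split; last by move=> j; rewrite qnumE => /andP[j0 jn]; rewrite -(prim_order_dvd prq) gtnNdvd.
  rewrite ltn_neqAle n0 andbT; apply: contraNneq q1 => n1.
  by rewrite -[q]expr1 n1 prim_expr_order.
by apply/eqP; rewrite qnumE prim_expr_order.
Qed.

Lemma linear_characterX (G : finGroupType) (chi : G -> k) g i :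
  linear_character chi -> chi (g ^+ i)%g = chi g ^+ i.
Proof.
move=> [chi1 chiM]; elim: i => [|i IH]; first by rewrite expg0 expr0.
by rewrite expgS exprS chiM IH.
Qed.

End Scalars.

(** * The two families *)

Section Classification.
Variables (k : fieldType) (H : hopfType k).
Hypotheses (rank1 : has_rank H 1) (gen : <<coradical1 H>>%AS = {:H}%AS).
Variable a : grp H.
Notation H0 := (coradical H).

Lemma conjXn (x : H) (g : grp H) i : (val g * x * val g^-1%g) ^+ i = val g * x ^+ i * val g^-1%g.
Proof.
elim: i => [|i IH]; first by rewrite !expr0 mulr1 -val_grpM mulgV.
rewrite !exprS IH !mulrA; congr (_ * _ * _).
by rewrite -[_ * val g^-1%g * _]mulrA -val_grpM mulVg mulr1.
Qed.

Lemma grpB1_pchar (g : grp H) p : p \in [pchar H] ->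
  (val g - 1) ^+ p = val (g ^+ p)%g - 1.
Proof.
move=> cpH; rewrite -(pFrobenius_autE cpH) pFrobenius_autB_comm; last exact: commr1.
by rewrite !pFrobenius_autE expr1n val_grpX.
Qed.

Lemma central_grp : (forall g : grp H, (g * a)%g = (a * g)%g) -> a \in 'Z([set: grp H])%g.
Proof. by move=> ca; rewrite inE in_setT; apply/centP => g _; rewrite /commute ca. Qed.

(** The cocycle law for [a g = g a] reads [c(g) = q c(g)], so [c = 0].  The
    scalar [alpha] is reset to [0] when [a^N = 1], where it is undetermined. *)
Lemma nontrivial_eigenvalue p (q : k) (z : H) :
  skew_primitive (val a) 1 z -> z \notin H0 ->
  val a * z * (val a)^-1 = q *: z -> q != 1 ->
  exists (R : datumR k) (N : nat) (A : hopfType k),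
    [/\ datumR_valid p R N, R_r R = 0%N, is_HR p R N A & hopf_isomorphic H A].
Proof.
move=> Dz zH0 eig q1.
have [chi [c [conj lin coc ca [chi0 /(_ q) chia]]]] := conj_data_exists rank1 Dz zH0.
have az : val a * z = q *: (z * val a).
  by rewrite scalerAl -eig mulrVK // grp_unit.
have {chia}[chia c_a] := chia az.
have q0 : q != 0 by rewrite -chia.
have c0 g : c g = 0.
  have := coc g a; rewrite -ca coc c_a mulr0 add0r addr0 chia => /eqP.
  rewrite -subr_eq0 -[X in _ - X]mul1r -mulrBl mulf_eq0 subr_eq0 (negPf q1).
  by move/eqP.
have {}conj (g : grp H) : val g * z * val g^-1%g = chi g *: z by rewrite conj c0 scale0r addr0.
have [N prN _] : {N | N.-primitive_root q & (N %| #[a]%g)%N}.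
  by apply: prim_order_exists; rewrite ?order_gt0 // -chia -linear_characterX // expg_order lin.1.
have qn := qchar_primitive_rootV prN q1.
have za : z * val a = q^-1 *: (val a * z) by rewrite az scalerA mulVf // scale1r.
have [beta [alpha [zN ba]]] := skew_primitive_power rank1 Dz zH0 qn za.
have beta0 : beta = 0.
  case: ba => // aN; case/eqP: q1.
  by rewrite -chia -aN linear_characterX // chia prim_expr_order.
have zNH0 : z ^+ N \in (H0 + <[z]>)%VS.
  rewrite zN beta0 scale0r add0r (subvP (addvSl _ _)) // memvZ //.
  by rewrite grpB1_coradical.
pose al := if (a ^+ N)%g == 1%g then 0 else alpha.
have zNal : z ^+ N = al *: (val (a ^+ N)%g - 1).
  rewrite zN beta0 scale0r add0r /al; case: eqP => // ->.
  by rewrite val_grp1 subrr !scaler0.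
have al_chi : al != 0 -> forall g, chi g ^+ N = 1.
  move=> al0 g; have aN1 : (a ^+ N)%g != 1%g.
    by apply: contraNneq al0; rewrite /al => ->; rewrite eqxx.
  have zN0 : z ^+ N != 0.
    rewrite zNal scaler_eq0 (negPf al0) subr_eq0 /=.
    by apply: contraNneq aN1 => E; apply/eqP/val_inj.
  have gaN : (g * a ^+ N)%g = (a ^+ N * g)%g by apply: commuteX; apply: ca.
  have := conjXn z g N; rewrite conj exprZn {2}zNal -scalerAr -scalerAl mulrBr mulrBl mulr1.
  rewrite -!val_grpM gaN mulgK mulgV val_grp1 -zNal => /eqP.
  by rewrite -subr_eq0 -[X in _ - X]scale1r -scalerBl scaler_eq0 (negPf zN0) orbF subr_eq0 => /eqP.
exists (DatumR chi a al (fun _ : 'I_0 => 0)), N, H; split=> //=; last exact: hopf_isomorphic_refl.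
  rewrite expn0 mul1n muln1; split; split=> //; rewrite ?chia //.
  - exact: central_grp.
  - by rewrite /al => ->; rewrite eqxx.
  - by case.
exists (fun g => val g), z; rewrite expn0 mul1n; split=> //.
- apply: (monomial_basis_grp rank1 Dz zH0 gen qn za (c := c)) => // g.
  by rewrite conj c0 scale0r addr0.
- by rewrite big_ord0 addr0.
- exact: skew_hopf_structure_grp.
Qed.

(** The conditions on the datum say that conjugation by [g] respects the
    relation for [x^p]; that [x] and [a] commute makes the [p]-th power of
    [chi(g) x + c(g) (a - 1)] computable by Frobenius. *)
Lemma trivial_eigenvalue_normal_form p (x : H) (al0 al1 : k) : p \in [pchar k] ->
  skew_primitive (val a) 1 x -> x \notin H0 -> val a * x = x * val a ->
  x ^+ p = al1 *: (val (a ^+ p)%g - 1) + al0 *: x ->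
  (al0 = 0 /\ al1 = 0) \/ (al0 = 1 /\ (a ^+ p)%g = a) ->
  exists (F : datumF k) (A : hopfType k),
    [/\ datumF_valid p F, is_HF p F A & hopf_isomorphic H A].
Proof.
move=> cp Dx xH0 ax xp al01.
have [chi [c [conj lin coc ca [chi0 /(_ 1) chia]]]] := conj_data_exists rank1 Dx xH0.
have {chia}[chia c_a] : chi a = 1 /\ c a = 0 by apply: chia; rewrite scale1r.
have cpH : p \in [pchar H] by rewrite pchar_lalg.
have conjp g : chi g ^+ p *: x ^+ p + c g ^+ p *: (val (a ^+ p)%g - 1) =
    al1 *: (val (a ^+ p)%g - 1) + al0 *: (chi g *: x + c g *: (val a - 1)).
  have comm1 : GRing.comm (chi g *: x) (c g *: (val a - 1)).
    rewrite /GRing.comm -!scalerAl -!scalerAr mulrBr mulrBl ax mulr1 mul1r.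
    by rewrite !scalerA mulrC.
  have aB := grpB1_pchar a cpH.
  have gaN : (g * a ^+ p)%g = (a ^+ p * g)%g by apply: commuteX; apply: ca.
  have -> : chi g ^+ p *: x ^+ p + c g ^+ p *: (val (a ^+ p)%g - 1) =
      (chi g *: x + c g *: (val a - 1)) ^+ p.
    by rewrite -[RHS](pFrobenius_autE cpH) pFrobenius_autD_comm // !pFrobenius_autE !exprZn aB.
  rewrite -conj conjXn xp mulrDr mulrDl -!scalerAr -!scalerAl; congr (_ *: _ + _).
  by rewrite mulrBr mulrBl mulr1 -!val_grpM gaN mulgK mulgV val_grp1.
exists (DatumF chi c a al1 al0), H; split; last exact: hopf_isomorphic_refl.
  split; split=> //; first exact: central_grp.
  - by case: al01 => -[]; [left|right].
  - by case: al01 => [[_ ->]//|[-> _] /eqP]; rewrite oner_eq0.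
  - move=> e0 g; case: al01 => [[_ e1]|[e1 _]]; last first.
      by move/eqP: e1; rewrite e0 eq_sym oner_eq0.
    have := conjp g; rewrite xp e0 e1 !scale0r !addr0 scaler0 add0r => /eqP.
    rewrite scaler_eq0 expf_eq0 => /orP[/andP[_ /eqP ->]|]; first by rewrite scale0r.
    rewrite subr_eq0 => /eqP E; have -> : (a ^+ p)%g = 1%g by apply: val_inj.
    by rewrite subrr scaler0.
  - move=> e1; case: al01 => [[e0 _]|[_ ap]]; first by move/eqP: e1; rewrite e0 eq_sym oner_eq0.
    split=> // g; have := conjp g; rewrite xp e1 ap !scale1r scalerDr scalerA => E.
    have [chip cE] : chi g ^+ p = chi g /\
        (a != 1%g -> chi g ^+ p * al1 + c g ^+ p = al1 + c g).
      apply: (skew_coords_inj xH0).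
      by rewrite scalerDl addrCA addrA E addrCA scalerDl.
    split.
      have [m mE] := pchar_prime_subfield cp chip; exists m => //.
      by rewrite (dvdn_pcharf cp) -mE.
    case: (eqVneq a 1%g) => [->|/cE]; first by rewrite subrr scaler0.
    rewrite chip => E2; have -> : al1 * (chi g - 1) + c g ^+ p - c g = 0.
      have -> : al1 * (chi g - 1) + c g ^+ p - c g = chi g * al1 + c g ^+ p - (al1 + c g) by ring.
      by rewrite E2 subrr.
    by rewrite scale0r.
exists (fun g => val g), x; split=> //; last exact: skew_hopf_structure_grp.
apply: (monomial_basis_grp rank1 Dx xH0 gen (qchar1 cp) (c := c) _ conj).
  by rewrite ax scale1r.
by rewrite xp memv_add ?memvZ ?memv_line ?grpB1_coradical.
Qed.

(** Solving [l^p = - alpha] kills [alpha] by a translation when [beta = 0];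
    solving [m^(p-1) = beta^-1] rescales [beta] to [1] otherwise, and then
    [a^p = a]. *)
Lemma trivial_eigenvalue p (z : H) : p \in [pchar k] -> GRing.closed_field_axiom k ->
  skew_primitive (val a) 1 z -> z \notin H0 -> val a * z * (val a)^-1 = z ->
  exists (F : datumF k) (A : hopfType k),
    [/\ datumF_valid p F, is_HF p F A & hopf_isomorphic H A].
Proof.
move=> cp closed Dz zH0 eig; have p0 := prime_gt0 (pcharf_prime cp).
have az : val a * z = z * val a by rewrite -{2}eig mulrVK // grp_unit.
have za1 : z * val a = 1 *: (val a * z) by rewrite scale1r.
have [beta [alpha [zp ba]]] := skew_primitive_power rank1 Dz zH0 (qchar1 cp) za1.
have cpH : p \in [pchar H] by rewrite pchar_lalg.
case: (eqVneq beta 0) => [beta0|beta0].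
  have [l lE] := closed_field_root (- alpha) closed p0.
  have aH0 : l *: (val a - 1) \in H0 by rewrite memvZ // grpB1_coradical.
  apply: (@trivial_eigenvalue_normal_form p (z + l *: (val a - 1)) 0 0) => //; last by left.
  - rewrite /skew_primitive linearD linearZ linearB /= Dz comul1 -pure1 (grpP a).1.
    rewrite pure_addl pure_addr pureZl pureZr.
    rewrite [RHS]addrACA -scalerDr; congr (_ + _ *: _).
    by rewrite pure_addl pure_addr pureNl pureNr addrA subrK.
  - by apply: contra zH0 => /memvB/(_ aH0); rewrite addrK.
  - by rewrite mulrDr mulrDl az -scalerAl -scalerAr mulrBr mulrBl mulr1 mul1r.
  - have comm1 : GRing.comm z (l *: (val a - 1)).
      by rewrite /GRing.comm -scalerAl -scalerAr mulrBr mulrBl az mulr1 mul1r.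
    have aB := grpB1_pchar a cpH.
    rewrite !scale0r addr0 -[LHS](pFrobenius_autE cpH) pFrobenius_autD_comm //.
    by rewrite !pFrobenius_autE exprZn aB zp beta0 scale0r add0r lE scaleNr subrr.
have p1 : (0 < p.-1)%N by rewrite -subn1 subn_gt0 (prime_gt1 (pcharf_prime cp)).
have ap : (a ^+ p)%g = a by case: ba => // /eqP; rewrite (negPf beta0).
have [m mE] := closed_field_root beta^-1 closed p1.
have m0 : m != 0.
  by apply: contraNneq beta0 => m0; rewrite -invr_eq0 -mE m0 expr0n gtn_eqF.
apply: (@trivial_eigenvalue_normal_form p (m *: z) 1 (m ^+ p * alpha)) => //; last by right.
- by rewrite /skew_primitive linearZ /= Dz scalerDr pureZl pureZr.
- by apply: contra zH0 => mz; rewrite -[z]scale1r -(mulVf m0) -scalerA; apply: memvZ.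
- by rewrite -scalerAr -scalerAl az.
- rewrite exprZn zp scalerDr !scalerA addrC mul1r; congr (_ + _ *: _).
  by rewrite -[p in m ^+ p](prednK p0) exprS -mulrA mE mulVf // mulr1.
Qed.

End Classification.

Theorem theorem3p11 (k : fieldType) (p : nat) (char_p : p \in [pchar k])
    (H : hopfType k) (rank1 : has_rank H 1)
    (gen : <<coradical1 H>>%AS = {:H}%AS)
    (a : H) (skew_a : skew_point a) (q : k)
    (eig : exists2 z : H, skew_primitive a 1 z /\ z \notin coradical H
                        & a * z * a^-1 = q *: z) :
  (q != 1 ->
     exists (R : datumR k) (N : nat) (A : hopfType k),
       [/\ datumR_valid p R N, R_r R = 0%N, is_HR p R N A
         & hopf_isomorphic H A]) /\
  (q = 1 -> GRing.closed_field_axiom k ->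
     exists (F : datumF k) (A : hopfType k),
       [/\ datumF_valid p F, is_HF p F A & hopf_isomorphic H A]).
Proof.
have [gl_a _] := skew_a; have [z [Dz zH0] az] := eig.
split=> [q1|q1 closed].
  exact: (nontrivial_eigenvalue rank1 gen (a := grp_of gl_a) p Dz zH0 az q1).
apply: (trivial_eigenvalue rank1 gen (a := grp_of gl_a) char_p closed Dz zH0).
by rewrite [LHS]az q1 scale1r.
Qed.
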